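(* Let $\{(R_n,B_n)\}_{n=1}^\infty\subseteq\mathcal{D}_d$ be a sequence of admissible pairs in $\mathbb{R}^d$. Suppose there is an admissible pair $(R,B)$ occurring infinitely many times in the sequence such that all diagonal entries of $R$ are $\ge d+1$. Then the infinite convolution $$\mu=\delta_{R_1^{-1}B_1}*\delta_{(R_2R_1)^{-1}B_2}*\cdots*\delta_{(R_n\cdots R_1)^{-1}B_n}*\cdots$$ is a spectral measure with a spectrum contained in $\mathbb{Z}^d$.
   Context: $\mathcal{D}_d$ is the set of pairs $(R,B)$ with $R=\mathrm{diag}(m_1,\dots,m_d)$, $m_1,\dots,m_d\ge2$ integers, and $B$ a nonempty subset of $\{0,\dots,m_1-1\}\times\cdots\times\{0,\dots,m_d-1\}$. For a finite $A\subseteq\mathbb{R}^d$, $\delta_A=\frac{1}{\#A}\sum_{a\in A}\delta_a$; for a sequence in $\mathcal{D}_d$ the finite convolutions $\delta_{R_1^{-1}B_1}*\cdots*\delta_{(R_n\cdots R_1)^{-1}B_n}$ converge weakly, and $\mu$ denotes the limit. A pair $(R,B)$ ($R$ expanding integer matrix, $B\subseteq\mathbb{Z}^d$ finite) is admissible if there is a finite $L\subseteq\mathbb{Z}^d$ with $\#L=\#B$ such that $\big[\frac{1}{\sqrt{\#B}}e^{-2\pi i(R^{-1}b)\cdot\ell}\big]_{b\in B,\ell\in L}$ is unitary. A Borel probability measure $\mu$ is spectral if there is a countable $\Lambda\subseteq\mathbb{R}^d$ (a spectrum) with $\{e^{2\pi i\lambda\cdot x}\}_{\lambda\in\Lambda}$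 an orthonormal basis of $L^2(\mu)$. *)

(* Defs.v *)
From HB Require Import structures.
From mathcomp Require Import all_boot all_order all_algebra.
From mathcomp Require Import complex.
From mathcomp Require Import all_classical all_reals all_analysis.
Set Implicit Arguments. Unset Strict Implicit. Unset Printing Implicit Defensive.
Import Order.TTheory GRing.Theory Num.Theory.
Import numFieldNormedType.Exports.
Local Open Scope classical_set_scope.
Local Open Scope ring_scope.


Definition Rd (R : realType) (d : nat) := g_sigma_algebraType (@open 'rV[R]_d).

Definition expi (R : realType) (t : R) : R[i] := ((cos t) +i* (sin t))%C.

Definition dotv (R : realType) (d : nat) (x y : 'rV[R]_d) : R :=
  \sum_(i < d) x 0 i * y 0 i.

(* A pair (R,B) of D_d: R = diag(m_1,...,m_d), B a finite set of integer
   vectors, represented by a duplicate-free sequence. *)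
Definition in_Dd (d : nat) (m : 'I_d -> nat) (B : seq 'rV[int]_d) : Prop :=
  (forall i, (2 <= m i)%N) /\ uniq B /\ (0 < size B)%N /\
  (forall b, b \in B -> forall i, (0 <= b 0 i) /\ (b 0 i < (m i)%:Z)).

Definition Rinv_dot (R : realType) (d : nat) (m : 'I_d -> nat)
    (b l : 'rV[int]_d) : R :=
  \sum_(i < d) ((b 0 i)%:~R / (m i)%:R) * (l 0 i)%:~R.

Definition adm_matrix (R : realType) (d : nat) (m : 'I_d -> nat)
    (B L : seq 'rV[int]_d) : 'M[R[i]]_(size B) :=
  \matrix_(j, k)
    (((Num.sqrt (size B)%:R)^-1)%:C%C *
      expi (- (2 * pi * Rinv_dot R m (nth 0 B j) (nth 0 L k)))).

Definition unitary_mx (R : realType) (n : nat) (U : 'M[R[i]]_n) : Prop :=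
  (map_mx conjc U)^T *m U = 1%:M /\ U *m (map_mx conjc U)^T = 1%:M.

Definition admissible (R : realType) (d : nat) (m : 'I_d -> nat)
    (B : seq 'rV[int]_d) : Prop :=
  exists L : seq 'rV[int]_d, uniq L /\ size L = size B /\
    unitary_mx (adm_matrix R m B L).

(* The sequence {(R_n,B_n)}_{n>=1} is given by m : nat -> 'I_d -> nat and
   Bs : nat -> seq, where index k : nat stands for n = k+1. *)

(* (R_{k+1} ... R_1)^{-1} b  (diagonal matrices) *)
Definition scaled_digit (R : realType) (d : nat) (m : nat -> 'I_d -> nat)
    (k : nat) (b : 'rV[int]_d) : 'rV[R]_d :=
  \row_(i < d) ((b 0 i)%:~R / (\prod_(j < k.+1) m j i)%:R).

(* The support points, with multiplicity, of
   delta_{R_1^{-1}B_1} * ... * delta_{(R_n...R_1)^{-1}B_n}: *)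
Fixpoint conv_points (R : realType) (d : nat) (m : nat -> 'I_d -> nat)
    (Bs : nat -> seq 'rV[int]_d) (n : nat) : seq 'rV[R]_d :=
  match n with
  | O => [:: 0]
  | n'.+1 => [seq x + scaled_digit R m n' b
               | x <- conv_points R m Bs n', b <- Bs n']
  end.

(* integral of f against the n-th finite convolution
   delta_{R_1^{-1}B_1} * ... * delta_{(R_n...R_1)^{-1}B_n}
   (each delta_A being the uniform probability on A) *)
Definition conv_integral (R : realType) (d : nat) (m : nat -> 'I_d -> nat)
    (Bs : nat -> seq 'rV[int]_d) (n : nat) (f : 'rV[R]_d -> R) : R :=
  (size (conv_points R m Bs n))%:R^-1 *
    \sum_(x <- conv_points R m Bs n) f x.

Definition weak_limit (R : realType) (d : nat) (m : nat -> 'I_d -> nat)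
    (Bs : nat -> seq 'rV[int]_d) (mu : probability (Rd R d) R) : Prop :=
  forall f : 'rV[R]_d -> R, continuous f -> (exists M : R, forall x, `|f x| <= M) ->
    (fun n => conv_integral m Bs n f) @ \oo --> Rintegral mu setT (f : Rd R d -> R).

Definition cintegral (R : realType) (d : nat) (mu : probability (Rd R d) R)
    (g : Rd R d -> R[i]) : R[i] :=
  ((Rintegral mu setT (fun x => complex.Re (g x))) +i* (Rintegral mu setT (fun x => complex.Im (g x))))%C.

Definition L2 (R : realType) (d : nat) (mu : probability (Rd R d) R)
    (g : Rd R d -> R[i]) : Prop :=
  measurable_fun setT (fun x => complex.Re (g x)) /\
  measurable_fun setT (fun x => complex.Im (g x)) /\
  mu.-integrable setT (fun x => ((complex.Re (g x)) ^+ 2 + (complex.Im (g x)) ^+ 2)%:E).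

Definition inner (R : realType) (d : nat) (mu : probability (Rd R d) R)
    (f g : Rd R d -> R[i]) : R[i] :=
  cintegral mu (fun x => f x * conjc (g x)).

Definition expo (R : realType) (d : nat) (lam : 'rV[R]_d) : Rd R d -> R[i] :=
  fun x => expi (2 * pi * dotv lam x).

Definition is_spectrum (R : realType) (d : nat) (mu : probability (Rd R d) R)
    (Lam : set 'rV[R]_d) : Prop :=
  countable Lam /\
  (forall lam, Lam lam -> L2 mu (expo lam)) /\
  (forall lam lam', Lam lam -> Lam lam' ->
     inner mu (expo lam) (expo lam') = (lam == lam')%:R) /\
  (forall f, L2 mu f -> (forall lam, Lam lam -> inner mu f (expo lam) = 0) ->
     {ae mu, forall x, f x = 0}).

Definition spectral (R : realType) (d : nat) (mu : probability (Rd R d) R) : Prop :=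
  exists Lam : set 'rV[R]_d, is_spectrum mu Lam.

Definition Zd (R : realType) (d : nat) : set 'rV[R]_d :=
  [set v | forall i, v 0 i \is a Num.int].

(* Main.v *)
Require Import Defs.
From HB Require Import structures.
From mathcomp Require Import all_boot all_order all_algebra.
From mathcomp Require Import complex.
From mathcomp Require Import all_classical all_reals all_analysis.
From mathcomp Require Import measurable_realfun.
From mathcomp Require Import ring lra zify.
Import Order.TTheory GRing.Theory Num.Theory.
Import numFieldNormedType.Exports.
Local Open Scope classical_set_scope.
Local Open Scope ring_scope.

(** Write [X_n] for the atoms of the [n]-th finite convolution, [P_n] for the
    product of the first [n] matrices and [T_{n,k}] for the atoms of the
    convolution of the levels [n, ..., n + k - 1], rescaled to the unit cube, so
    that [X_{n+k} = X_n + P_n^-1 T_{n,k}].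

    Admissibility gives, at each level, finite sets [S] of integer vectors for
    which Parseval's identity holds on [X_n]; this survives the passage to the next
    level and arbitrary translations of the elements of [S] by [P_n Z^d].  These
    translations are used to keep the Fourier transform of the tail away from
    zero on [S].  That this is possible is an equipositivity statement: if all
    [m_i >= d + 1] and the tail starts with [(diag m, B)], some integer translate
    of any frequency has a tail transform of modulus bounded below.  Indeed, test
    the tail against a nonnegative trigonometric kernel concentrated near one of
    its points, [q = m^-1 (b0 + t0)].  The test can only fail if mass near [q] is
    cancelled by mass near some [q + z], with [z <> 0] integral; choosing [b0] to
    minimise [sum_i sgn_i b_i / m_i], with signs read off [t0], excludes this
    because [d / (d + 1) < 1].

    The union [Lambda] of the resulting nested sets [S_j] is orthonormal in
    [L^2(mu)] by weak convergence.  For a bounded Lipschitz [g], comparing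
    Parseval's identity at level [n_j] with the Fourier coefficients of [g] for
    [mu] gives [eps ||g||^2 <= 2 sum_{Lambda} |<g, e_l>|^2].  By density of such
    [g] and Bessel's inequality a function orthogonal to [Lambda] vanishes. *)

Set Implicit Arguments. Unset Strict Implicit. Unset Printing Implicit Defensive.

Local Notation Re := complex.Re.
Local Notation Im := complex.Im.
Local Notation "a %:C" := (@real_complex _ a) : ring_scope.

(** * Complex numbers and means over finite sequences *)

Section SquaredModulus.
Variable R : rcfType.
Implicit Types (a : R) (z w : R[i]).

Lemma ReM z w : Re (z * w) = Re z * Re w - Im z * Im w.
Proof. by case: z; case: w. Qed.

Lemma ImM z w : Im (z * w) = Re z * Im w + Im z * Re w.
Proof. by case: z; case: w. Qed.

Lemma Re_realM a z : Re (a%:C * z) = a * Re z.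
Proof. by rewrite ReM /= mul0r subr0. Qed.

Lemma Im_realM a z : Im (a%:C * z) = a * Im z.
Proof. by rewrite ImM /= mul0r addr0. Qed.

Lemma Re_sum (I : Type) (r : seq I) (F : I -> R[i]) :
  Re (\sum_(i <- r) F i) = \sum_(i <- r) Re (F i).
Proof. exact: raddf_sum. Qed.

Definition sqnormc z : R := Re z ^+ 2 + Im z ^+ 2.

Lemma sqnormc_ge0 z : 0 <= sqnormc z.
Proof. by rewrite addr_ge0 ?sqr_ge0. Qed.

Lemma sqr_Re_le z : Re z ^+ 2 <= sqnormc z.
Proof. by rewrite lerDl sqr_ge0. Qed.

Lemma sqr_Im_le z : Im z ^+ 2 <= sqnormc z.
Proof. by rewrite lerDr sqr_ge0. Qed.

Lemma sqnormcM z w : sqnormc (z * w) = sqnormc z * sqnormc w.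
Proof. by rewrite /sqnormc ReM ImM; ring. Qed.

Lemma sqnormcN z : sqnormc (- z) = sqnormc z.
Proof. by rewrite /sqnormc !raddfN !sqrrN. Qed.

Lemma sqnormc_conj z : sqnormc (conjc z) = sqnormc z.
Proof. by case: z => a b; rewrite /sqnormc /= sqrrN. Qed.

Lemma sqnormc_real a : sqnormc a%:C = a ^+ 2.
Proof. by rewrite /sqnormc /= expr0n addr0. Qed.

Lemma sqnormc1 : sqnormc 1 = 1.
Proof. by rewrite sqnormc_real expr1n. Qed.

Lemma sqnormc_eq0 z : (sqnormc z == 0) = (z == 0).
Proof. by rewrite /sqnormc paddr_eq0 ?sqr_ge0 // !sqrf_eq0 eq_complex. Qed.

Lemma mulc_conj z : z * conjc z = (sqnormc z)%:C.
Proof. by rewrite -sqr_normc -add_Re2_Im2. Qed.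

Lemma sqnormcD_le z w : sqnormc (z + w) <= 2 * (sqnormc z + sqnormc w).
Proof.
rewrite /sqnormc !raddfD /=.
have := sqr_ge0 (Re z - Re w); have := sqr_ge0 (Im z - Im w); nra.
Qed.

End SquaredModulus.

Section UnitCircle.
Variable R : realType.
Implicit Types t s : R.

Definition expi2pi t : R[i] := expi (2 * pi * t).

Lemma expi2piD t s : expi2pi (t + s) = expi2pi t * expi2pi s.
Proof.
apply/eqP; rewrite eq_complex ReM ImM /= mulrDr cosD sinD.
by rewrite [sin _ * _ + _]addrC !eqxx.
Qed.

Lemma expi2pi0 : expi2pi 0 = 1.
Proof. by rewrite /expi2pi mulr0 /expi cos0 sin0. Qed.

Lemma expi2piN t : expi2pi (- t) = conjc (expi2pi t).
Proof. by rewrite /expi2pi mulrN /expi cosN sinN. Qed.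

Lemma expi2pi_sum (I : Type) (r : seq I) (F : I -> R) :
  expi2pi (\sum_(i <- r) F i) = \prod_(i <- r) expi2pi (F i).
Proof. exact: (big_morph _ expi2piD expi2pi0). Qed.

Lemma expi2piMn t n : expi2pi (t *+ n) = expi2pi t ^+ n.
Proof. by elim: n => [|n IHn]; rewrite ?expi2pi0 // mulrS expi2piD IHn exprS. Qed.

Lemma expi2pi_int (k : int) : expi2pi k%:~R = 1.
Proof.
have nat_case n : expi2pi n%:R = 1.
  by rewrite expi2piMn /expi2pi mulr1 /expi mulr_natl cos2pi sin2pi expr1n.
by case: k => n; rewrite ?NegzE ?mulrNz ?expi2piN nat_case ?conjc1.
Qed.

Lemma sqnormc_expi2pi t : sqnormc (expi2pi t) = 1.
Proof. exact: cos2Dsin2. Qed.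

Lemma sqr_cos_expi2pi s :
  (cos (pi * s) ^+ 2)%:C = expi2pi s * (1 + expi2pi (- s)) ^+ 2 / 4.
Proof.
have -> : expi2pi s * (1 + expi2pi (- s)) ^+ 2 = expi2pi s +
    2 * (expi2pi s * expi2pi (- s)) + expi2pi s * expi2pi (- s) * expi2pi (- s) by ring.
rewrite -expi2piD subrr expi2pi0 mulr1 mul1r.
rewrite expi2piN; apply: (canRL (mulfK _)); first by rewrite pnatr_eq0.
apply/eqP; rewrite -[4](rmorph_nat (real_complex R)) mulrC eq_complex Re_realM Im_realM.
rewrite !raddfD /= (_ : 2 * pi * s = (pi * s) *+ 2) ?cos_mulr2n; last by ring.
by apply/andP; split; apply/eqP; ring.
Qed.

Lemma Re_expi2pi_ge_half t : `|t| <= 8^-1 -> 2^-1 <= Re (expi2pi t).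
Proof.
rewrite ler_norml => /andP[t_ge t_le] /=; have pi0 := pi_gt0 R.
have /andP[c0 c1] : 0 <= cos (2 * pi * t) <= 1.
  by rewrite cos_le1 andbT; apply: cos_ge0_pihalf; apply/andP; split; nra.
have : 0 <= cos ((2 * pi * t) *+ 2).
  by apply: cos_ge0_pihalf; apply/andP; split; nra.
by rewrite cos_mulr2n; move: c0 c1; nra.
Qed.

End UnitCircle.

Section Mean.

Definition mean (F : fieldType) (T : Type) (X : seq T) (f : T -> F) : F :=
  (size X)%:R^-1 * \sum_(x <- X) f x.

Section Field.
Variables (F : fieldType) (T : Type).
Implicit Types (X : seq T) (f g : T -> F).

Lemma eq_mean X f g : f =1 g -> mean X f = mean X g.
Proof. by move=> /funext ->. Qed.

Lemma meanD X f g : mean X (fun x => f x + g x) = mean X f + mean X g.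
Proof. by rewrite /mean big_split mulrDr. Qed.

Lemma meanZl c X f : mean X (fun x => c * f x) = c * mean X f.
Proof. by rewrite /mean -mulr_sumr mulrCA. Qed.

Lemma mean_sum (I : Type) (r : seq I) X (f : I -> T -> F) :
  mean X (fun x => \sum_(i <- r) f i x) = \sum_(i <- r) mean X (f i).
Proof. by rewrite /mean exchange_big mulr_sumr. Qed.

Lemma exchange_mean (T' : Type) X (Y : seq T') (f : T -> T' -> F) :
  mean X (fun x => mean Y (f x)) = mean Y (fun y => mean X (f^~ y)).
Proof. by rewrite /mean -!mulr_sumr mulrCA exchange_big. Qed.

Lemma mean_map (T' : Type) (h : T' -> T) (Y : seq T') f :
  mean [seq h y | y <- Y] f = mean Y (fun y => f (h y)).
Proof. by rewrite /mean size_map big_map. Qed.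

Lemma mean_allpairs (T1 T2 : Type) (h : T1 -> T2 -> T) (Y : seq T1) (Z : seq T2) f :
  mean [seq h y z | y <- Y, z <- Z] f = mean Y (fun y => mean Z (fun z => f (h y z))).
Proof.
by rewrite /mean -mulr_sumr mulrA -invfM -natrM size_allpairs big_allpairs_dep.
Qed.

End Field.

Lemma mulr_mean (F : fieldType) (T T' : Type) (X : seq T) (Y : seq T')
    (f : T -> F) (g : T' -> F) :
  mean X f * mean Y g = mean X (fun x => mean Y (fun y => f x * g y)).
Proof.
transitivity (mean X (fun x => mean Y g * f x)); first by rewrite meanZl mulrC.
by apply: eq_mean => x; rewrite meanZl mulrC.
Qed.

Lemma eq_in_mean (F : fieldType) (T : eqType) (X : seq T) (f g : T -> F) :
  {in X, f =1 g} -> mean X f = mean X g.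
Proof. by move=> fg; rewrite /mean; congr (_ * _); exact: eq_big_seq. Qed.

Lemma perm_mean (F : fieldType) (T : eqType) (X Y : seq T) (f : T -> F) :
  perm_eq X Y -> mean X f = mean Y f.
Proof. by move=> XY; rewrite /mean (perm_size XY) (perm_big _ XY). Qed.

Lemma mean_cst (F : numFieldType) (T : Type) (X : seq T) (c : F) :
  (0 < size X)%N -> mean X (fun=> c) = c.
Proof.
move=> X0; rewrite /mean big_const_seq count_predT iter_addr_0 -[c *+ _]mulr_natl.
by rewrite mulKf // pnatr_eq0 -lt0n.
Qed.

Lemma mean_ge0 (R : realFieldType) (T : Type) (X : seq T) (f : T -> R) :
  (forall x, 0 <= f x) -> 0 <= mean X f.
Proof. by move=> f0; rewrite mulr_ge0 ?invr_ge0 // sumr_ge0. Qed.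

Lemma sqr_mean_le (R : realFieldType) (T : Type) (X : seq T) (f : T -> R) :
  mean X f ^+ 2 <= mean X (fun x => f x ^+ 2).
Proof.
have [/size0nil->|X0] := posnP (size X).
  by rewrite /mean !big_nil !mulr0 expr0n.
pose m := mean X f.
have -> : (fun x => f x ^+ 2) =
    (fun x => (f x - m) ^+ 2 + ((2 * m) * f x + - m ^+ 2)) by apply/funext => x; ring.
rewrite !meanD meanZl mean_cst // -/m.
have : 0 <= mean X (fun x => (f x - m) ^+ 2) by apply: mean_ge0 => x; exact: sqr_ge0.
by move: (mean X _) => v; lra.
Qed.

Section Order.
Variables (R : realFieldType) (T : eqType).
Implicit Types (X : seq T) (f g : T -> R).

Lemma ler_mean X f g : {in X, forall x, f x <= g x} -> mean X f <= mean X g.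
Proof.
move=> fg; rewrite ler_wpM2l ?invr_ge0 // big_seq [leRHS]big_seq.
exact: ler_sum.
Qed.

Lemma mean_le_cst X f c : (0 < size X)%N -> {in X, forall x, f x <= c} -> mean X f <= c.
Proof. by move=> X0 fc; rewrite -[leRHS](mean_cst c X0); exact: ler_mean. Qed.

Lemma mean_ge_cst X f c : (0 < size X)%N -> {in X, forall x, c <= f x} -> c <= mean X f.
Proof. by move=> X0 fc; rewrite -[leLHS](mean_cst c X0); exact: ler_mean. Qed.

Lemma exists_argmax X f : (0 < size X)%N ->
  exists2 x, x \in X & {in X, forall y, f y <= f x}.
Proof.
case: X => // x0 X _; pose i0 : 'I_(size (x0 :: X)) := ord0.
have [i _ imax] := Order.TotalTheory.arg_maxP
  (fun i : 'I_(size (x0 :: X)) => f (nth x0 (x0 :: X) i)) (isT : xpredT i0).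
exists (nth x0 (x0 :: X) i); first exact: mem_nth.
by move=> _ /(nthP x0) [j jX <-]; exact: (imax (Ordinal jX)).
Qed.

Lemma exists_ge_mean X f : (0 < size X)%N -> exists2 x, x \in X & mean X f <= f x.
Proof.
by move=> X0; have [x xX xmax] := exists_argmax f X0; exists x; last exact: mean_le_cst.
Qed.

Lemma mean_ge_term x X f : x \in X -> (forall y, 0 <= f y) -> (size X)%:R^-1 * f x <= mean X f.
Proof.
move=> xX f0; rewrite ler_wpM2l ?invr_ge0 // (big_rem x) //= lerDl.
exact: sumr_ge0.
Qed.

End Order.

Section Complex.
Variables (R : rcfType) (T : Type).
Implicit Types (X : seq T) (f : T -> R[i]).

Lemma Re_mean X f : Re (mean X f) = mean X (fun x => Re (f x)).
Proof.
by rewrite /mean -(rmorph_nat (real_complex R)) -fmorphV Re_realM Re_sum.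
Qed.

Lemma Im_mean X f : Im (mean X f) = mean X (fun x => Im (f x)).
Proof.
by rewrite /mean -(rmorph_nat (real_complex R)) -fmorphV Im_realM raddf_sum.
Qed.

Lemma conjc_mean X f : conjc (mean X f) = mean X (fun x => conjc (f x)).
Proof. by rewrite /mean rmorphM fmorphV rmorph_nat rmorph_sum. Qed.

Lemma realc_mean X (f : T -> R) : (mean X f)%:C = mean X (fun x => (f x)%:C).
Proof. by rewrite /mean rmorphM fmorphV rmorph_nat rmorph_sum. Qed.

Lemma sqnormc_mean_le X f : sqnormc (mean X f) <= mean X (fun x => sqnormc (f x)).
Proof. by rewrite /sqnormc Re_mean Im_mean meanD lerD // sqr_mean_le. Qed.

End Complex.

End Mean.

(** * Finite spectra *)

Section Parseval.
Variable R : rcfType.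

(* Equivalently, the [chi l], [l] in [S], are an orthonormal basis of the square
   integrable functions for the uniform probability measure on [X]. *)
Definition parseval (T U : Type) (chi : U -> T -> R[i]) (X : seq T) (S : seq U) : Prop :=
  forall g : T -> R[i],
    \sum_(l <- S) sqnormc (mean X (fun x => g x * chi l x)) =
    mean X (fun x => sqnormc (g x)).

Lemma parseval_map (T : eqType) (U U' : Type) (chi : U -> T -> R[i])
    (chi' : U' -> T -> R[i]) (f : U -> U') (w : T -> R[i]) X S :
  (forall x, sqnormc (w x) = 1) ->
  (forall l, {in X, forall x, chi' (f l) x = w x * chi l x}) ->
  parseval chi X S -> parseval chi' X [seq f l | l <- S].
Proof.
move=> w1 chi'E S_parseval g; rewrite big_map.
transitivity (mean X (fun x => sqnormc (g x * w x))).
  rewrite -S_parseval; apply: eq_bigr => l _; congr sqnormc; apply: eq_in_mean => x xX.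
  by rewrite chi'E // mulrA.
by apply: eq_mean => x; rewrite sqnormcM w1 mulr1.
Qed.

(* A twisted tensor product, as in Dita's construction of Hadamard matrices. *)
Lemma parseval_allpairs (T1 : eqType) (T2 T U1 U2 U : Type)
    (chi1 : U1 -> T1 -> R[i]) (chi2 : U2 -> T2 -> R[i]) (chi : U -> T -> R[i])
    (pt : T1 -> T2 -> T) (fr : U1 -> U2 -> U) (w : U1 -> T2 -> R[i]) X Y S L :
  (forall l y, sqnormc (w l y) = 1) ->
  (forall l k y, {in X, forall x,
     chi (fr l k) (pt x y) = w l y * chi1 l x * chi2 k y}) ->
  parseval chi1 X S -> parseval chi2 Y L ->
  parseval chi [seq pt x y | x <- X, y <- Y] [seq fr l k | l <- S, k <- L].
Proof.
move=> w1 chiE S_parseval L_parseval g; rewrite big_allpairs_dep mean_allpairs exchange_mean /=.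
pose h l y := w l y * mean X (fun x => g (pt x y) * chi1 l x).
transitivity (\sum_(l <- S) mean Y (fun y => sqnormc (h l y))).
  apply: eq_bigr => l _; rewrite -L_parseval; apply: eq_bigr => k _; congr sqnormc.
  rewrite mean_allpairs exchange_mean; apply: eq_mean => y.
  rewrite /h -meanZl mulrC -meanZl; apply: eq_in_mean => x xX.
  by rewrite chiE //; ring.
rewrite -mean_sum; apply: eq_mean => y.
by rewrite -S_parseval; apply: eq_bigr => l _; rewrite sqnormcM w1 mul1r.
Qed.

Section Orthogonality.
Variables (T U : eqType) (chi : U -> T -> R[i]) (X : seq T) (S : seq U).
Hypothesis X_neq0 : (0 < size X)%N.
Hypothesis sqnormc_chi : forall l x, sqnormc (chi l x) = 1.
Hypothesis S_parseval : parseval chi X S.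

(* Parseval for [conj (chi l)]: the term of index [l] already exhausts the sum. *)
Lemma parseval_rem_orthogonal l k : l \in S -> k \in rem l S ->
  mean X (fun x => conjc (chi l x) * chi k x) = 0.
Proof.
move=> lS kS; apply/eqP; rewrite -sqnormc_eq0; apply/eqP.
pose c j := sqnormc (mean X (fun x => conjc (chi l x) * chi j x)).
have c_ge0 j : 0 <= c j by exact: sqnormc_ge0.
have mean1 (F : numFieldType) (f : T -> F) : (forall x, f x = 1) -> mean X f = 1.
  by move=> f1; rewrite -[RHS](mean_cst _ X_neq0); congr mean; apply/funext.
have cl : c l = 1.
  by rewrite /c mean1 ?sqnormc1 // => x; rewrite mulrC mulc_conj sqnormc_chi.
have := S_parseval (fun x => conjc (chi l x)).
rewrite [RHS]mean1 => [|x]; last by rewrite sqnormc_conj.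
rewrite -/(c _) (big_rem l) //= -/(c _) cl (big_rem k) //= -!/(c _).
have : 0 <= \sum_(j <- rem k (rem l S)) c j by exact: sumr_ge0.
have := c_ge0 k; rewrite /c; set s := \sum_(j <- _) _; lra.
Qed.

Lemma parseval_orthogonal l k : l \in S -> k \in S -> l != k ->
  mean X (fun x => conjc (chi l x) * chi k x) = 0.
Proof.
by move=> lS kS lk; apply: parseval_rem_orthogonal; rewrite // rem_mem // eq_sym.
Qed.

Lemma parseval_uniq : uniq S.
Proof.
apply: count_mem_uniq => l; have [lS|/count_memPn //] := boolP (l \in S).
have [|l2] := leqP (count_mem l S) 1.
  by rewrite leq_eqVlt ltnS leqn0 => /predU1P[// | /eqP/count_memPn]; rewrite lS.
have : mean X (fun x => conjc (chi l x) * chi l x) = 0.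
  apply: parseval_rem_orthogonal => //.
  by rewrite -has_pred1 has_count count_rem lS /= eqxx subn_gt0.
under eq_fun do rewrite mulrC mulc_conj sqnormc_chi.
by rewrite mean_cst // => /eqP; rewrite oner_eq0.
Qed.

End Orthogonality.

End Parseval.

Section Admissible.
Variables (R : realType) (d : nat).
Implicit Types (m : 'I_d -> nat) (b l : 'rV[int]_d) (B L : seq 'rV[int]_d).

Lemma unitary_mx_isometry n (U : 'M[R[i]]_n) (v : 'rV[R[i]]_n) : unitary_mx U ->
  \sum_k sqnormc ((v *m U) 0 k) = \sum_k sqnormc (v 0 k).
Proof.
have normE (u : 'rV[R[i]]_n) :
    (u *m (map_mx conjc u)^T) 0 0 = (\sum_k sqnormc (u 0 k))%:C.
  by rewrite mxE rmorph_sum; apply: eq_bigr => k _; rewrite !mxE mulc_conj.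
move=> [_ UU]; apply: (@complexI R).
by rewrite -!normE map_mxM trmx_mul mulmxA -(mulmxA v) UU mulmx1.
Qed.

Definition Rinv_char m l b : R[i] := expi2pi (- Rinv_dot R m b l).

Lemma adm_matrixE m B L j k : adm_matrix R m B L j k =
  ((Num.sqrt (size B)%:R)^-1)%:C * Rinv_char m (nth 0 L k) (nth 0 B j).
Proof. by rewrite mxE /Rinv_char /expi2pi mulrN. Qed.

Lemma unitary_adm_matrix_parseval m B L : (0 < size B)%N -> size L = size B ->
  unitary_mx (adm_matrix R m B L) -> parseval (Rinv_char m) B L.
Proof.
move=> B_gt0 sL UL g; pose v : 'rV[R[i]]_(size B) := \row_j g (nth 0 B j).
pose a : R := (Num.sqrt (size B)%:R)^-1.
have a2 : a ^+ 2 = (size B)%:R^-1 by rewrite exprVn sqr_sqrtr.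
have vU k : sqnormc ((v *m adm_matrix R m B L) 0 k) =
    (size B)%:R * sqnormc (mean B (fun b => g b * Rinv_char m (nth 0 L k) b)).
  rewrite !mxE (_ : \sum_j _ = (a * (size B)%:R)%:C *
      mean B (fun b => g b * Rinv_char m (nth 0 L k) b)).
    rewrite sqnormcM sqnormc_real exprMn a2 expr2 mulrA mulVf ?mul1r //.
    by rewrite pnatr_eq0 -lt0n.
  rewrite rmorphM rmorph_nat /mean -mulrA mulVKf ?pnatr_eq0 -?lt0n //.
  rewrite (big_nth 0) big_mkord mulr_sumr; apply: eq_bigr => j _.
  by rewrite adm_matrixE mxE mulrCA.
have := unitary_mx_isometry v UL.
under eq_bigr do rewrite vU; rewrite -mulr_sumr => /(canRL (mulKf _)) E.
rewrite (big_nth 0) sL big_mkord E ?pnatr_eq0 -?lt0n //.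
rewrite /mean (big_nth 0) big_mkord; congr (_ * _).
by apply: eq_bigr => j _; rewrite mxE.
Qed.

Lemma Rinv_dotB m b l l' :
  Rinv_dot R m b (l - l') = Rinv_dot R m b l - Rinv_dot R m b l'.
Proof.
by rewrite /Rinv_dot -sumrB; apply: eq_bigr => i _; rewrite !mxE intrB mulrBr.
Qed.

Lemma admissible_parseval m B : (0 < size B)%N -> admissible R m B ->
  exists2 L, parseval (Rinv_char m) B L & 0 \in L.
Proof.
move=> B_gt0 [L [_ [sL /(unitary_adm_matrix_parseval B_gt0 sL) L_parseval]]].
pose l0 := nth 0 L 0; exists [seq l - l0 | l <- L]; last first.
  by apply/mapP; exists l0; rewrite ?subrr ?mem_nth ?sL.
apply: (parseval_map (w := fun b => expi2pi (Rinv_dot R m b l0)) _ _ L_parseval) => [b|l b _].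
  exact: sqnormc_expi2pi.
by rewrite /Rinv_char Rinv_dotB opprB expi2piD.
Qed.

End Admissible.

(** * Fourier transforms of finite sets *)

Section Vectors.
Variables (R : realType) (d : nat).
Implicit Types (l : 'rV[int]_d) (x y u v : 'rV[R]_d) (m : 'I_d -> nat).

Definition intrv l : 'rV[R]_d := map_mx intr l.

Lemma intrvD l l' : intrv (l + l') = intrv l + intrv l'.
Proof. exact: map_mxD. Qed.

Lemma intrv_inj : injective intrv.
Proof.
by move=> l l' /rowP ll'; apply/rowP => i; have := ll' i; rewrite !mxE => /intr_inj.
Qed.

Lemma dotvDl u v x : dotv (u + v) x = dotv u x + dotv v x.
Proof. by rewrite /dotv -big_split; apply: eq_bigr => i _; rewrite mxE mulrDl. Qed.

Lemma dotvDr u x y : dotv u (x + y) = dotv u x + dotv u y.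
Proof. by rewrite /dotv -big_split; apply: eq_bigr => i _; rewrite mxE mulrDr. Qed.

Lemma dotvNl u x : dotv (- u) x = - dotv u x.
Proof. by rewrite /dotv -sumrN; apply: eq_bigr => i _; rewrite mxE mulNr. Qed.

Lemma dotvNr u x : dotv u (- x) = - dotv u x.
Proof. by rewrite /dotv -sumrN; apply: eq_bigr => i _; rewrite mxE mulrN. Qed.

Lemma dotv0r u : dotv u 0 = 0.
Proof. by rewrite /dotv big1 // => i _; rewrite mxE mulr0. Qed.

Lemma norm_dotv_le u x c : (forall i, `|x 0 i| <= c) ->
  `|dotv u x| <= (\sum_i `|u 0 i|) * c.
Proof.
move=> xc; rewrite /dotv mulr_suml; apply: le_trans (ler_norm_sum _ _ _) _.
by apply: ler_sum => i _; rewrite normrM ler_wpM2l.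
Qed.

Lemma norm_coord_le x i : `|x 0 i| <= `|x|.
Proof.
by rewrite [leRHS]/Num.norm /= mx_normrE; apply/bigmax_geP; right; exists (0, i).
Qed.

Lemma rV_norm_le x c : 0 <= c -> (forall i, `|x 0 i| <= c) -> `|x| <= c.
Proof.
move=> c0 xc; rewrite [leLHS]/Num.norm /= mx_normrE; apply: bigmax_le => // -[i j] _ /=.
by rewrite (ord1 i).
Qed.

(* [scalez m] and [unscale m] are the actions of diag(m) and of its inverse. *)
Definition scalez m l : 'rV[int]_d := \row_i ((m i)%:Z * l 0 i).

Definition unscale m x : 'rV[R]_d := \row_i (x 0 i / (m i)%:R).

Lemma scalez0 m : scalez m 0 = 0.
Proof. by apply/rowP => i; rewrite !mxE mulr0. Qed.

Lemma unscaleD m x y : unscale m (x + y) = unscale m x + unscale m y.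
Proof. by apply/rowP => i; rewrite !mxE mulrDl. Qed.

Lemma unscale_mul m m' x :
  unscale (fun i => m i * m' i)%N x = unscale m (unscale m' x).
Proof. by apply/rowP => i; rewrite !mxE natrM invfM mulrA mulrAC. Qed.

Lemma unscale_scalez m l : (forall i, 0 < m i)%N -> unscale m (intrv (scalez m l)) = intrv l.
Proof.
move=> m0; apply/rowP => i; rewrite !mxE intrM -pmulrn mulrAC mulfV ?mul1r //.
by rewrite pnatr_eq0 -lt0n.
Qed.

Lemma dotv_unscale m u x : dotv (unscale m u) x = dotv u (unscale m x).
Proof. by apply: eq_bigr => i _; rewrite !mxE mulrAC mulrA. Qed.

Lemma Rinv_dotE m b l : Rinv_dot R m b l = dotv (intrv l) (unscale m (intrv b)).
Proof. by apply: eq_bigr => i _; rewrite !mxE mulrC. Qed.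

End Vectors.

Section FourierTransform.
Variables (R : realType) (d : nat).
Implicit Types (l : 'rV[int]_d) (x xi : 'rV[R]_d) (X Y : seq 'rV[R]_d).

Definition echar l x : R[i] := expi2pi (- dotv (intrv R l) x).

Definition fourier X xi : R[i] := mean X (fun x => expi2pi (- dotv xi x)).

Definition energy X xi : R := sqnormc (fourier X xi).

Lemma sqnormc_echar l x : sqnormc (echar l x) = 1.
Proof. exact: sqnormc_expi2pi. Qed.

Lemma echarDr l x y : echar l (x + y) = echar l x * echar l y.
Proof. by rewrite /echar dotvDr opprD expi2piD. Qed.

Lemma echarDl l l' x : echar (l + l') x = echar l x * echar l' x.
Proof. by rewrite /echar intrvD dotvDl opprD expi2piD. Qed.

Lemma echarNr l x : echar l (- x) = conjc (echar l x).
Proof. by rewrite /echar dotvNr -expi2piN. Qed.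

Lemma conjc_echar l x : conjc (echar l x) = expi2pi (dotv (intrv R l) x).
Proof. by rewrite -expi2piN opprK. Qed.

Lemma energy_le1 X xi : (0 < size X)%N -> energy X xi <= 1.
Proof.
move=> X0; apply: le_trans (sqnormc_mean_le _ _) _; apply: mean_le_cst => // x _.
by rewrite sqnormc_expi2pi.
Qed.

Lemma perm_energy X Y xi : perm_eq X Y -> energy X xi = energy Y xi.
Proof. by move=> XY; rewrite /energy /fourier (perm_mean _ XY). Qed.

Lemma energy_map_unscale m X xi :
  energy [seq unscale m x | x <- X] xi = energy X (unscale m xi).
Proof.
by congr sqnormc; rewrite /fourier mean_map; apply: eq_mean => x; rewrite dotv_unscale.
Qed.

Lemma energy_translate X c xi : energy [seq x + c | x <- X] xi = energy X xi.
Proof.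
rewrite /energy /fourier mean_map.
transitivity (sqnormc (expi2pi (- dotv xi c) * mean X (fun x => expi2pi (- dotv xi x)))).
  congr sqnormc; rewrite -meanZl; apply: eq_mean => x.
  by rewrite -expi2piD -opprD dotvDr addrC.
by rewrite sqnormcM sqnormc_expi2pi mul1r.
Qed.

Lemma energy_sumset X Y xi :
  energy [seq x + y | x <- X, y <- Y] xi = energy X xi * energy Y xi.
Proof.
rewrite -sqnormcM /fourier mulr_mean /energy /fourier mean_allpairs; congr sqnormc.
by do 2 (apply: eq_mean => ?); rewrite dotvDr opprD expi2piD.
Qed.

Lemma energy_ge_quarter X xi : (0 < size X)%N ->
  {in X, forall x, `|dotv xi x| <= 8^-1} -> 4^-1 <= energy X xi.
Proof.
move=> X0 small; apply: le_trans (sqr_Re_le _); rewrite Re_mean.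
have : 2^-1 <= mean X (fun x => Re (expi2pi (- dotv xi x))).
  by apply: mean_ge_cst => // x xX; apply: Re_expi2pi_ge_half; rewrite normrN small.
by move: (mean _ _) => c; nra.
Qed.

End FourierTransform.

(** * Equipositivity *)

Section CosineKernel.
Variable R : realType.

Definition binom_weight r j : R := 'C(r.*2, j)%:R / 4 ^+ r.

Lemma binom_weight_ge0 r j : 0 <= binom_weight r j.
Proof. by rewrite divr_ge0 ?exprn_ge0. Qed.

Lemma cos_pow_fourier r (s : R) : ((cos (pi * s) ^+ 2) ^+ r)%:C =
  \sum_(j < r.*2.+1) (binom_weight r j)%:C * expi2pi (- ((j%:Z - r%:Z)%:~R * s)).
Proof.
rewrite rmorphXn /= sqr_cos_expi2pi expr_div_n exprMn -exprM mul2n exprDn.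
rewrite mulr_sumr mulr_suml; apply: eq_bigr => j _.
have -> : - ((j%:Z - r%:Z)%:~R * s) = s *+ r + - s *+ j.
  by rewrite intrB -!pmulrn -[s *+ r]mulr_natl -[- s *+ j]mulr_natl; ring.
rewrite expr1n mul1r -!expi2piMn mulrnAr -expi2piD /binom_weight.
rewrite rmorphM fmorphV rmorphXn !rmorph_nat /= -[expi2pi _ *+ _]mulr_natl.
by rewrite mulrAC.
Qed.

Lemma central_binom_weight_ge r : r.+1%:R^-1 <= binom_weight r r.
Proof.
have r1 : 0 < r.+1%:R :> R by rewrite ltr0n.
have mean_bin : mean (index_enum 'I_r.+1) (fun j => 'C(r, j)%:R : R) = 2 ^+ r / r.+1%:R.
  rewrite /mean /index_enum -enumT size_enum_ord mulrC big_enum /=; congr (_ / _).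
  rewrite (_ : 2 = 1 + 1) // exprDn; apply: eq_bigr => j _.
  by rewrite !expr1n mulr1.
have mean_sqr_bin : mean (index_enum 'I_r.+1) (fun j => ('C(r, j)%:R : R) ^+ 2) =
    'C(r.*2, r)%:R / r.+1%:R.
  rewrite /mean /index_enum -enumT size_enum_ord mulrC big_enum /=; congr (_ / _).
  rewrite -addnn -binomial.Vandermonde natr_sum; apply: eq_bigr => j _.
  by rewrite natrM bin_sub ?expr2 // -ltnS.
have := sqr_mean_le (index_enum 'I_r.+1) (fun j => 'C(r, j)%:R : R).
rewrite mean_bin mean_sqr_bin expr_div_n -exprM mulnC exprM expr2 invfM mulrA ler_pM2r ?invr_gt0 //.
rewrite /binom_weight ler_pdivlMr ?exprn_gt0 // mulrC.
by rewrite -natrM.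
Qed.

Variable d : nat.
Implicit Types (s t x q : 'rV[R]_d).

(* A nonnegative trigonometric polynomial concentrated, for large [r], near the
   integer points, and whose Fourier coefficients form a probability vector. *)
Definition cos_kernel r s : R := \prod_i (cos (pi * s 0 i) ^+ 2) ^+ r.

Local Notation multi_index r := {ffun 'I_d -> 'I_(r.*2.+1)}.

Definition kernel_freq r (f : multi_index r) : 'rV[int]_d := \row_i ((f i)%:Z - r%:Z).

Definition kernel_weight r (f : multi_index r) : R := \prod_i binom_weight r (f i).

Lemma kernel_weight_ge0 r (f : multi_index r) : 0 <= kernel_weight f.
Proof. by apply: prodr_ge0 => i _; exact: binom_weight_ge0. Qed.

Lemma cos_kernel_ge0 r s : 0 <= cos_kernel r s.
Proof. by apply: prodr_ge0 => i _; rewrite exprn_ge0 // sqr_ge0. Qed.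

Lemma cos_kernel_fourier r s : (cos_kernel r s)%:C =
  \sum_(f : multi_index r) (kernel_weight f)%:C * echar (kernel_freq f) s.
Proof.
rewrite rmorph_prod /=; under eq_bigr do rewrite cos_pow_fourier.
rewrite bigA_distr_bigA; apply: eq_bigr => f _.
rewrite big_split rmorph_prod /echar /dotv -sumrN expi2pi_sum; congr (_ * _).
by apply: eq_bigr => i _; rewrite !mxE.
Qed.

Lemma sum_kernel_weight r : \sum_(f : multi_index r) kernel_weight f = 1.
Proof.
have kernel0 : cos_kernel r 0 = 1.
  by rewrite /cos_kernel big1 // => i _; rewrite mxE mulr0 cos0 !expr1n.
apply: (@complexI R); rewrite -kernel0 cos_kernel_fourier rmorph_sum.
by apply: eq_bigr => f _; rewrite /echar dotv0r oppr0 expi2pi0 mulr1.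
Qed.

Lemma cos_kernel_le_factor r s i : cos_kernel r s <= (cos (pi * s 0 i) ^+ 2) ^+ r.
Proof.
rewrite /cos_kernel (bigD1 i) //= ler_piMr //; first by rewrite exprn_ge0 // sqr_ge0.
apply: Num.Theory.prodr_ile1 => j _; rewrite exprn_ge0 ?sqr_ge0 //=.
by rewrite exprn_ile1 ?sqr_ge0 // -real_normK ?num_real // exprn_ile1 // cos_max.
Qed.

Lemma exists_ge_kernel_average r (z : multi_index r -> R) (a : R) :
  a <= \sum_f kernel_weight f * z f -> exists f, a <= z f.
Proof.
have [f _ fmax] := Order.TotalTheory.arg_maxP z (isT : xpredT [ffun=> ord0]).
move=> /le_trans az; exists f; apply: az.
rewrite -[leRHS]mul1r -(sum_kernel_weight r) mulr_suml; apply: ler_sum => g _.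
by rewrite ler_wpM2l ?kernel_weight_ge0 //; exact: fmax.
Qed.

(* The left-hand side is an average, with the weights of the kernel, of Fourier
   coefficients of [X] at the points [x + kernel_freq f]. *)
Lemma exists_kernel_freq_energy_ge r (X : seq 'rV[R]_d) x q (a : R) : 0 <= a ->
  a <= mean X (fun u => cos_kernel r (u - q) * Re (expi2pi (dotv x (u - q)))) ->
  exists f : multi_index r, a ^+ 2 <= energy X (x + intrv R (kernel_freq f)).
Proof.
move=> a0; pose Xq := [seq u - q | u <- X].
pose z (f : multi_index r) := fourier Xq (x + intrv R (kernel_freq f)).
have -> : mean X (fun u => cos_kernel r (u - q) * Re (expi2pi (dotv x (u - q)))) =
    \sum_f kernel_weight f * Re (z f).
  rewrite -(mean_map _ X (fun u => cos_kernel r u * Re (expi2pi (dotv x u)))) -/Xq.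
  under [RHS]eq_bigr do rewrite Re_mean -meanZl; rewrite -mean_sum.
  apply: eq_mean => u; pose y := expi2pi (- dotv x u).
  transitivity (Re ((cos_kernel r u)%:C * y)).
    by rewrite Re_realM /y expi2piN; case: (expi2pi _).
  rewrite cos_kernel_fourier mulr_suml Re_sum; apply: eq_bigr => f _.
  by rewrite -mulrA Re_realM dotvDl opprD expi2piD [echar _ _ * y]mulrC.
move=> /exists_ge_kernel_average [f az]; exists f.
rewrite -(energy_translate _ (- q)); apply: le_trans (sqr_Re_le _).
by rewrite ler_pXn2r // nnegrE (le_trans a0).
Qed.

Lemma mean_cos_kernel_sub r (T : seq 'rV[R]_d) :
  mean T (fun t0 => mean T (fun t => cos_kernel r (t - t0))) =
  \sum_(f : multi_index r) kernel_weight f * energy T (intrv R (kernel_freq f)).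
Proof.
apply: (@complexI R); rewrite rmorph_sum realc_mean.
transitivity (mean T (fun t0 => mean T (fun t => \sum_(f : multi_index r)
    (kernel_weight f)%:C * (conjc (echar (kernel_freq f) t0) * echar (kernel_freq f) t)))).
  apply: eq_mean => t0; rewrite realc_mean; apply: eq_mean => t.
  rewrite cos_kernel_fourier; apply: eq_bigr => f _; congr (_ * _).
  by rewrite echarDr echarNr mulrC.
under eq_mean do rewrite mean_sum.
rewrite mean_sum; apply: eq_bigr => f _.
rewrite [RHS]rmorphM /= -mulc_conj [fourier _ _ * _]mulrC conjc_mean mulr_mean -meanZl.
by apply: eq_mean => t0; rewrite -meanZl.
Qed.

(* The kernel is positive definite, so its double average over [T] is at least the
   weight of its zero frequency. *)
Lemma cos_kernel_concentration r (T : seq 'rV[R]_d) : (0 < size T)%N ->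
  exists2 t0, t0 \in T & r.+1%:R^-1 ^+ d <= mean T (fun t => cos_kernel r (t - t0)).
Proof.
move=> T0.
have [t0 t0T le_mean] := exists_ge_mean (fun t0 => mean T (fun t => cos_kernel r (t - t0))) T0.
exists t0 => //; apply: le_trans le_mean; rewrite mean_cos_kernel_sub.
have mid : (r < r.*2.+1)%N by rewrite ltnS -addnn leq_addr.
pose fmid : multi_index r := [ffun=> Ordinal mid].
have freq0 : kernel_freq fmid = 0 by apply/rowP => i; rewrite !mxE ffunE subrr.
have energy1 : energy T (intrv R (kernel_freq fmid)) = 1.
  rewrite /energy /fourier freq0 -[RHS]sqnormc1 -[in RHS](mean_cst 1 T0).
  congr sqnormc; apply: eq_mean => t.
  by rewrite /dotv big1 ?oppr0 ?expi2pi0 // => i _; rewrite !mxE mul0r.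
rewrite (bigD1 fmid) //= energy1 mulr1 -[leLHS]addr0; apply: lerD; last first.
  by apply: sumr_ge0 => f _; rewrite mulr_ge0 ?kernel_weight_ge0 ?sqnormc_ge0.
rewrite /kernel_weight (eq_bigr (fun=> binom_weight r r)) => [|i _]; last by rewrite ffunE.
rewrite prodr_const card_ord; apply: lerXn2r; rewrite ?nnegrE ?binom_weight_ge0 ?invr_ge0 //.
exact: central_binom_weight_ge.
Qed.

End CosineKernel.

Section PolynomialTimesGeometric.
Variable R : realType.

Lemma natS_mul_expr_le (s : R) n : 0 <= s < 1 -> n.+1%:R * s ^+ n <= (1 - s)^-1.
Proof.
move=> /andP[s0 s1]; rewrite -[leRHS]mul1r ler_pdivlMr ?subr_gt0 //.
have : n.+1%:R * s ^+ n <= \sum_(i < n.+1) s ^+ i.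
  rewrite mulr_natl -[in leLHS](card_ord n.+1) -sumr_const.
  by apply: ler_sum => i _; rewrite ler_wiXn2l ?(ltW s1) // -ltnS.
have := subrX1 s n.+1; have : 0 <= s ^+ n.+1 by rewrite exprn_ge0.
by move: (\sum_(i < _) _) (_ * s ^+ n) (s ^+ n.+1) => S a b; nra.
Qed.

Lemma exists_poly_mul_expr_lt (d : nat) (rho c : R) : 0 <= rho < 1 -> 0 < c ->
  exists n : nat, n.+1%:R ^+ d * rho ^+ n < c.
Proof.
move=> /andP[rho0 rho1] c0; pose s := rho `^ d.+1%:R^-1.
have s0 : 0 <= s by exact: powR_ge0.
have sX : s ^+ d.+1 = rho by rewrite -powR_mulrn // -powRrM mulVf ?powRr1 // pnatr_eq0.
have s1 : s < 1 by rewrite -(@expr_lt1 _ d.+1) // sX.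
pose K := (1 - s)^-1 ^+ d; have K0 : 0 < K by rewrite exprn_gt0 // invr_gt0 subr_gt0.
have /cvgrPdist_lt/(_ _ (divr_gt0 c0 K0)) : (fun n => s ^+ n) @ \oo --> (0 : R).
  by apply: cvg_expr; rewrite ger0_norm.
move=> [n _ /(_ n (leqnn n))]; rewrite /= sub0r normrN ger0_norm ?exprn_ge0 //.
rewrite ltr_pdivlMr // => sK; exists n; apply: le_lt_trans sK.
rewrite -sX -exprM mulnC exprM exprSr mulrA -exprMn mulrC ler_wpM2l ?exprn_ge0 //.
apply: lerXn2r; rewrite ?nnegrE ?mulr_ge0 ?exprn_ge0 ?invr_ge0 ?subr_ge0 ?(ltW s1) //.
by apply: natS_mul_expr_le; rewrite s0.
Qed.

End PolynomialTimesGeometric.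

Section KernelLocalization.
Variable R : realType.

Lemma sqr_cos_sub_int (s : R) (k : int) : cos (pi * (s - k%:~R)) ^+ 2 = cos (pi * s) ^+ 2.
Proof.
apply: (@complexI R); rewrite !sqr_cos_expi2pi opprB -mulrNz.
by rewrite ![in LHS]expi2piD !expi2pi_int mul1r mulr1.
Qed.

Lemma sqr_cos_gt_near_int (th s : R) : 0 < th <= 2^-1 ->
  cos (pi * th) ^+ 2 < cos (pi * s) ^+ 2 -> exists k : int, `|s - k%:~R| < th.
Proof.
move=> /andP[th0 th1] cos_gt; pose k := Num.floor (s + 2^-1); exists k.
have := floor_itv (s + 2^-1); rewrite -/k intrD => /andP[k_le k_gt].
have pi0 := pi_gt0 R; set u := `|s - k%:~R|.
have u1 : u <= 2^-1 by rewrite ler_norml; lra.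
have us : cos (pi * u) ^+ 2 = cos (pi * s) ^+ 2.
  by rewrite -(sqr_cos_sub_int s k) -[in RHS]cos_norm normrM (gtr0_norm pi0).
apply: contraTT cos_gt; rewrite -us -!leNgt => thu.
have cos_u0 : 0 <= cos (pi * u) by apply: cos_ge0_pihalf; apply/andP; split; nra.
have : cos (pi * u) <= cos (pi * th).
  by rewrite leNgt ltr_cos ?in_itv /= ?ltr_pM2l // -?leNgt //; apply/andP; split; nra.
by move: cos_u0; nra.
Qed.

Lemma cos_kernel_gt_near_int (d r : nat) (th : R) (s : 'rV[R]_d) : 0 < th <= 2^-1 ->
  (cos (pi * th) ^+ 2) ^+ r < cos_kernel r s ->
  exists z : 'rV[int]_d, forall i, `|s 0 i - (z 0 i)%:~R| < th.
Proof.
move=> th01 big.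
have near i : exists k : int, `|s 0 i - k%:~R| < th.
  apply: sqr_cos_gt_near_int => //; rewrite ltNge; apply/negP => far.
  have := lt_le_trans big (cos_kernel_le_factor r s i); apply/negP; rewrite -leNgt.
  by apply: lerXn2r; rewrite ?nnegrE ?sqr_ge0.
have [z Hz] := fin_all_exists near.
by exists (\row_i z i) => i; rewrite mxE.
Qed.

End KernelLocalization.

Section NoWrap.
Variables (R : realType) (d : nat).
Implicit Types (m : 'I_d -> nat) (b z : 'rV[int]_d) (t : 'rV[R]_d).

Definition in_digit_box m b : Prop := forall i, 0 <= b 0 i < (m i)%:Z.

Definition in_unit_cube t : Prop := forall i, 0 <= t 0 i <= 1.

Definition half_sign (t : R) : int := if t <= 2^-1 then -1 else 1.

Definition signed_height m t b : R :=
  \sum_i (half_sign (t 0 i) * b 0 i)%:~R / (m i)%:R.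

Lemma carry_bounds (t0 t : R) (D : int) : 0 <= t0 <= 1 -> 0 <= t <= 1 ->
  `|D%:~R + t - t0| < 2^-1 -> 0 <= half_sign t0 * D <= 1.
Proof.
move=> /andP[t00 t01] /andP[t_ge0 t_le1]; rewrite ltr_norml => /andP[D_gt D_lt].
rewrite /half_sign; case: ifPn => [t0_le|]; last rewrite -ltNge => t0_gt.
- have : D%:~R < 1%:~R :> R by lra.
  have : (-2)%:~R < D%:~R :> R by lra.
  by rewrite !ltr_int; lia.
- have : D%:~R < 2%:~R :> R by lra.
  have : (-1)%:~R < D%:~R :> R by lra.
  by rewrite !ltr_int; lia.
Qed.

Lemma wrap_sign (t : R) (M : nat) (u v z : int) :
  0 <= u < M%:Z -> 0 <= v < M%:Z -> 0 <= half_sign t * (u - v - M%:Z * z) ->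
  half_sign t * z <= 0.
Proof. by rewrite /half_sign; case: ifP => _; rewrite ?mulN1r ?mul1r; nia. Qed.

(* A wrap-around by [m z] changes the signed height by at least [1], whereas the
   carry [b - b0 - m z], with entries in {0, sign}, changes it by at most
   [d / (d + 1)]. *)
Lemma no_wrap m b0 b t0 t z :
  (forall i, d < m i)%N -> in_digit_box m b0 -> in_digit_box m b ->
  in_unit_cube t0 -> in_unit_cube t ->
  signed_height m t0 b0 <= signed_height m t0 b ->
  (forall i, `|(b 0 i - b0 0 i - (m i)%:Z * z 0 i)%:~R + t 0 i - t0 0 i| < 2^-1) ->
  z = 0.
Proof.
move=> dm b0m bm t01 t1 height_le near.
pose sg i := half_sign (t0 0 i).
pose D i := b 0 i - b0 0 i - (m i)%:Z * z 0 i.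
have carry i : 0 <= sg i * D i <= 1 by exact: carry_bounds (t01 i) (t1 i) (near i).
have wrap i : sg i * z 0 i <= 0.
  by have /andP[? _] := carry i; exact: wrap_sign (bm i) (b0m i) _.
have m0 i : 0 < (m i)%:R :> R by rewrite ltr0n (leq_trans _ (dm i)).
have height_change : signed_height m t0 b - signed_height m t0 b0 =
    \sum_i (sg i * D i)%:~R / (m i)%:R + \sum_i (sg i * z 0 i)%:~R.
  rewrite /signed_height -sumrB -big_split /=; apply: eq_bigr => i _.
  by rewrite -/(sg i) !intrM /D !intrB intrM -pmulrn; field; rewrite gt_eqF.
have carry_lt1 : \sum_i (sg i * D i)%:~R / (m i)%:R < 1 :> R.
  apply: (@le_lt_trans _ _ (\sum_(i < d) d.+1%:R^-1)).
    apply: ler_sum => i _; have /andP[D_ge0 D_le1] := carry i.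
    rewrite -[leRHS]mul1r; apply: ler_pM; rewrite ?ler0z ?lerz1 ?invr_ge0 //.
    by rewrite lef_pV2 ?posrE // ler_nat.
  by rewrite sumr_const card_ord -[_ *+ d]mulr_natl ltr_pdivrMr ?ltr0n // mul1r ltr_nat.
have wrap_ge0 i : 0 <= sg i * z 0 i.
  have sum_le : \sum_j (sg j * z 0 j)%:~R <= (sg i * z 0 i)%:~R :> R.
    by rewrite (bigD1 i) //= gerDl sumr_le0 // => j _; rewrite lerz0.
  have : (-1)%:~R < (sg i * z 0 i)%:~R :> R.
    by rewrite mulrNz mulr1z; move: height_le height_change; lra.
  by rewrite ltr_int; lia.
apply/rowP => i; rewrite mxE; have := wrap i; have := wrap_ge0 i.
by rewrite /sg /half_sign; case: ifP => _; lia.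
Qed.

End NoWrap.

Section Equipositivity.
Variables (R : realType) (d : nat) (m : 'I_d -> nat).
Hypothesis d_lt_m : forall i, (d < m i)%N.
Implicit Types (b : 'rV[int]_d) (t x : 'rV[R]_d) (B : seq 'rV[int]_d) (T : seq 'rV[R]_d).

Definition cell_point b t : 'rV[R]_d := unscale m (intrv R b + t).

(* Small enough for an error of this size in every coordinate of a difference of
   two cell points neither to hide a wrap-around nor to move the phase of a
   frequency of the unit cube by more than 1/8. *)
Definition cell_radius : R := (8 * (d + \sum_i m i).+1)%:R^-1.

Let m_gt0 i : 0 < (m i)%:R :> R.
Proof. by rewrite ltr0n (leq_trans _ (d_lt_m i)). Qed.

Lemma natr_mul_cell_radius_le k : (k <= (d + \sum_i m i).+1)%N -> k%:R * cell_radius <= 8^-1.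
Proof.
move=> kM; rewrite /cell_radius natrM invfM mulrCA ler_piMr // ler_pdivrMr ?ltr0n //.
by rewrite mul1r ler_nat.
Qed.

Lemma cell_radius_gt0 : 0 < cell_radius.
Proof. by rewrite invr_gt0 ltr0n muln_gt0. Qed.

Lemma mul_cell_radius_le i : (m i)%:R * cell_radius <= 8^-1.
Proof.
by apply: natr_mul_cell_radius_le; rewrite (bigD1 i) //= leqW // addnCA leq_addr.
Qed.

Lemma dim_mul_cell_radius_le : d%:R * cell_radius <= 8^-1.
Proof. by apply: natr_mul_cell_radius_le; rewrite leqW // leq_addr. Qed.

Lemma cell_radius_le : cell_radius <= 8^-1.
Proof. by rewrite -[leLHS]mul1r; exact: (@natr_mul_cell_radius_le 1). Qed.

Definition cell_decay : R := cos (pi * cell_radius) ^+ 2.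

Lemma cell_decay_itv : 0 <= cell_decay < 1.
Proof.
have := pi_gt0 R; have := cell_radius_gt0; have := cell_radius_le.
rewrite /cell_decay; set th := cell_radius => th1 th0 pi0; rewrite sqr_ge0 /=.
have cos_ge0 : 0 <= cos (pi * th) by apply: cos_ge0_pihalf; apply/andP; split; nra.
have : cos (pi * th) < cos 0.
  by rewrite ltr_cos ?in_itv /= ?mulr_gt0 ?lexx //; apply/andP; split; nra.
by rewrite cos0; nra.
Qed.

Lemma cell_difference_near b0 b t0 t (z : 'rV[int]_d) :
  in_digit_box m b0 -> in_digit_box m b -> in_unit_cube t0 -> in_unit_cube t ->
  signed_height m t0 b0 <= signed_height m t0 b ->
  (forall i, `|(cell_point b t - cell_point b0 t0) 0 i - (z 0 i)%:~R| < cell_radius) ->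
  z = 0.
Proof.
move=> b0m bm t01 t1 height_le near; apply: (no_wrap d_lt_m b0m bm t01 t1) => // i.
have -> : (b 0 i - b0 0 i - (m i)%:Z * z 0 i)%:~R + t 0 i - t0 0 i =
    (m i)%:R * ((cell_point b t - cell_point b0 t0) 0 i - (z 0 i)%:~R).
  by rewrite !mxE !intrB intrM -pmulrn; field; rewrite gt_eqF.
rewrite normrM gtr0_norm //; have := near i.
rewrite -(ltr_pM2l (m_gt0 i)) => /lt_trans; apply.
by apply: le_lt_trans (mul_cell_radius_le i) _; lra.
Qed.

Lemma Re_expi2pi_dotv_ge_half x (s : 'rV[R]_d) : in_unit_cube x ->
  (forall i, `|s 0 i| <= cell_radius) -> 2^-1 <= Re (expi2pi (dotv x s)).
Proof.
move=> x1 small; apply: Re_expi2pi_ge_half; apply: le_trans (norm_dotv_le _ small) _.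
apply: le_trans dim_mul_cell_radius_le; rewrite ler_wpM2r ?(ltW cell_radius_gt0) //.
rewrite -[d in leRHS]card_ord -sumr_const; apply: ler_sum => i _.
by have /andP[x_ge0 x_le1] := x1 i; rewrite ger0_norm.
Qed.

Lemma cell_kernel_term_ge r b0 b t0 t x (s := cell_point b t - cell_point b0 t0) :
  in_digit_box m b0 -> in_digit_box m b -> in_unit_cube t0 -> in_unit_cube t ->
  in_unit_cube x -> signed_height m t0 b0 <= signed_height m t0 b ->
  2^-1 * cos_kernel r s - 3 / 2 * cell_decay ^+ r <=
  cos_kernel r s * Re (expi2pi (dotv x s)).
Proof.
move=> b0m bm t01 t1 x1 height_le; have ker0 := cos_kernel_ge0 r s.
have cos_geN1 : -1 <= Re (expi2pi (dotv x s)) by exact: cos_geN1.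
have [far|near] := leP (cos_kernel r s) (cell_decay ^+ r); first by nra.
have rad : 0 < cell_radius <= 2^-1.
  by rewrite cell_radius_gt0 (le_trans cell_radius_le) // lef_pV2 ?posrE // ler_nat.
have [z Hz] := cos_kernel_gt_near_int rad near.
have z0 := cell_difference_near b0m bm t01 t1 height_le Hz.
have : 2^-1 <= Re (expi2pi (dotv x s)).
  apply: Re_expi2pi_dotv_ge_half => // i.
  by have := Hz i; rewrite z0 [X in X%:~R]mxE subr0 => /ltW.
have : 0 <= cell_decay ^+ r by rewrite exprn_ge0 //; case/andP: cell_decay_itv.
by move: ker0; nra.
Qed.

Lemma mean_cell_kernel_ge r B T x b0 t0 (q := cell_point b0 t0) :
  {in B, forall b, in_digit_box m b} -> {in T, forall t, in_unit_cube t} ->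
  in_unit_cube x -> b0 \in B -> t0 \in T ->
  {in B, forall b, signed_height m t0 b0 <= signed_height m t0 b} ->
  2^-1 * ((size B)%:R^-1 * mean [seq unscale m t | t <- T]
      (fun t => cos_kernel r (t - unscale m t0))) - 3 / 2 * cell_decay ^+ r <=
  mean [seq cell_point b t | b <- B, t <- T]
    (fun u => cos_kernel r (u - q) * Re (expi2pi (dotv x (u - q)))).
Proof.
move=> Bm T1 x1 b0B t0T b0min; set X := [seq _ | _ <- _, _ <- _].
have BT0 : (0 < size X)%N.
  by rewrite size_allpairs muln_gt0; apply/andP; split;
    [case: (B) b0B | case: (T) t0T].
apply: (@le_trans _ _ (mean X (fun u => 2^-1 * cos_kernel r (u - q) +
    - (3 / 2 * cell_decay ^+ r)))); last first.
  apply: ler_mean => _ /allpairsP [[b t] /= [bB tT ->]].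
  by apply: cell_kernel_term_ge; rewrite ?b0min; auto.
rewrite meanD meanZl mean_cst // lerD2r ler_pM2l ?invr_gt0 // mean_allpairs.
have -> : mean [seq unscale m t | t <- T] (fun t => cos_kernel r (t - unscale m t0)) =
    mean T (fun t => cos_kernel r (cell_point b0 t - q)).
  rewrite mean_map; apply: eq_mean => t; congr cos_kernel.
  by rewrite /q /cell_point !unscaleD opprD addrACA subrr add0r.
apply: (mean_ge_term (f := fun b => mean T (fun t => cos_kernel r (cell_point b t - q)))) => //.
by move=> b; apply: mean_ge0 => t; exact: cos_kernel_ge0.
Qed.

Lemma equipositive_cells B : (0 < size B)%N -> {in B, forall b, in_digit_box m b} ->
  exists2 eps : R, 0 < eps & exists r : nat, forall T x,
    (0 < size T)%N -> {in T, forall t, in_unit_cube t} -> in_unit_cube x ->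
    exists f : {ffun 'I_d -> 'I_(r.*2.+1)},
      eps <= energy [seq cell_point b t | b <- B, t <- T] (x + intrv R (kernel_freq f)).
Proof.
move=> B0 Bm; have N0 : 0 < (size B)%:R :> R by rewrite ltr0n.
have c0 : 0 < (6 * (size B)%:R)^-1 :> R by rewrite invr_gt0 mulr_gt0.
have [r decay_lt] := exists_poly_mul_expr_lt d cell_decay_itv c0.
pose w : R := r.+1%:R^-1 ^+ d; have w0 : 0 < w by rewrite exprn_gt0 // invr_gt0.
pose del := w / (4 * (size B)%:R); have del0 : 0 < del by rewrite divr_gt0 ?mulr_gt0.
have decay_le : 3 / 2 * cell_decay ^+ r <= del.
  move: decay_lt; rewrite -ltr_pdivlMl ?exprn_gt0 // -exprVn -/w => /ltW.
  rewrite -(ler_pM2l (_ : 0 < 3 / 2)) // => /le_trans; apply.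
  by rewrite le_eqVlt; apply/orP; left; apply/eqP; rewrite /del; field; rewrite gt_eqF.
exists (del ^+ 2); first by rewrite exprn_gt0.
exists r => T x T0 T1 x1; pose mT := [seq unscale m t | t <- T].
have [|_ /mapP[t0 t0T ->] ker_t0] := @cos_kernel_concentration _ _ r mT.
  by rewrite size_map.
have [b0 b0B b0max] := exists_argmax (fun b => - signed_height m t0 b) B0.
apply: (exists_kernel_freq_energy_ge (q := cell_point b0 t0) (ltW del0)).
have b0min : {in B, forall b, signed_height m t0 b0 <= signed_height m t0 b}.
  by move=> b /b0max; rewrite lerN2.
apply: le_trans (mean_cell_kernel_ge r Bm T1 x1 b0B t0T b0min).
have : (size B)%:R^-1 * w <= (size B)%:R^-1 * mean mT
    (fun t => cos_kernel r (t - unscale m t0)) by rewrite ler_wpM2l ?invr_ge0.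
have -> : (size B)%:R^-1 * w = 4 * del by rewrite /del; field; rewrite gt_eqF.
by move: (_ * mean _ _) => a; lra.
Qed.

End Equipositivity.

(** * Finite convolutions and the tower of spectra *)

Section ConvolutionPoints.
Variables (R : realType) (d : nat).
Implicit Types (m : nat -> 'I_d -> nat) (Bs : nat -> seq 'rV[int]_d).

Definition level_scale m n (i : 'I_d) : nat := \prod_(j < n) m j i.

Definition drop_levels (A : Type) n (u : nat -> A) : nat -> A := fun k => u (n + k)%N.

Lemma level_scaleD m n k :
  level_scale m (n + k) = (fun i => level_scale m n i * level_scale (drop_levels n m) k i)%N.
Proof. by apply/funext => i; rewrite /level_scale big_split_ord. Qed.

Lemma scaled_digitE m n b :
  scaled_digit R m n b = unscale (level_scale m n.+1) (intrv R b).
Proof. by apply/rowP => i; rewrite !mxE. Qed.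

Lemma conv_pointsD m Bs n k : conv_points R m Bs (n + k) =
  [seq x + unscale (level_scale m n) y | x <- conv_points R m Bs n,
     y <- conv_points R (drop_levels n m) (drop_levels n Bs) k].
Proof.
elim: k => [|k IHk].
  rewrite addn0 /= allpairs1r -[LHS]map_id; apply: eq_map => x.
  by apply/rowP => i; rewrite !mxE mul0r addr0.
rewrite addnS /= {}IHk -/(drop_levels n Bs k).
elim: (conv_points R m Bs n) => //= x X IHX.
rewrite allpairs_cat IHX allpairs_mapl map_allpairs; congr (_ ++ _).
apply: eq_allpairs => // y b; rewrite -addrA unscaleD; congr (_ + (_ + _)).
by rewrite !scaled_digitE -unscale_mul -level_scaleD addnS.
Qed.

Lemma conv_pointsS m Bs k : conv_points R m Bs k.+1 =
  [seq cell_point (m 0) b y | b <- Bs 0,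
     y <- conv_points R (drop_levels 1 m) (drop_levels 1 Bs) k].
Proof.
have scale1 : level_scale m 1 = m 0 by apply/funext => i; rewrite /level_scale big_ord1.
rewrite [LHS](conv_pointsD m Bs 1 k) scale1 /= cats0 allpairs_mapl; apply: eq_allpairs => // b y.
by rewrite add0r scaled_digitE scale1 -unscaleD.
Qed.

Definition Dd_seq m Bs : Prop := forall n, in_Dd (m n) (Bs n).

Lemma Dd_drop_levels m Bs n : Dd_seq m Bs -> Dd_seq (drop_levels n m) (drop_levels n Bs).
Proof. by move=> mBs_Dd k; exact: mBs_Dd. Qed.

Section DdSequence.
Variables (m : nat -> 'I_d -> nat) (Bs : nat -> seq 'rV[int]_d).
Hypothesis mBs_Dd : Dd_seq m Bs.

Lemma level_scale_ge n i : (2 ^ n <= level_scale m n i)%N.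
Proof.
elim: n => [|n IHn]; first by rewrite /level_scale big_ord0.
rewrite /level_scale big_ord_recr expnSr leq_mul //.
by case: (mBs_Dd n) => + _; apply.
Qed.

Lemma level_scale_gt0 n i : (0 < level_scale m n i)%N.
Proof. by apply: leq_trans (level_scale_ge n i); rewrite expn_gt0. Qed.

Lemma level_scale_inv_le n i : (level_scale m n i)%:R^-1 <= (2 ^+ n)^-1 :> R.
Proof.
rewrite lef_pV2 ?posrE ?exprn_gt0 ?ltr0n ?level_scale_gt0 //.
by rewrite -natrX ler_nat level_scale_ge.
Qed.

Lemma size_digits_gt0 n : (0 < size (Bs n))%N.
Proof. by case: (mBs_Dd n) => _ [_ []]. Qed.

Lemma digits_in_box n b : b \in Bs n -> in_digit_box (m n) b.
Proof. by case: (mBs_Dd n) => _ [_ [_ +]] bB i => /(_ b bB i)[-> ->]. Qed.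

Lemma size_conv_points_gt0 n : (0 < size (conv_points R m Bs n))%N.
Proof. by elim: n => //= n IHn; rewrite size_allpairs muln_gt0 IHn size_digits_gt0. Qed.

Lemma energy_conv_points_mono n k xi : (n <= k)%N ->
  energy (conv_points R m Bs k) xi <= energy (conv_points R m Bs n) xi.
Proof.
move=> /subnKC <-; elim: (k - n)%N => [|j IHj]; first by rewrite addn0.
rewrite addnS /= -(allpairs_mapr +%R (fun _ => scaled_digit R m (n + j))) energy_sumset.
apply: le_trans IHj; rewrite ler_piMr ?sqnormc_ge0 // energy_le1 //.
by rewrite size_map size_digits_gt0.
Qed.

Lemma conv_points_lattice n x i : x \in conv_points R m Bs n ->
  exists k : int, (level_scale m n i)%:R * x 0 i = k%:~R.
Proof.
elim: n x => [|n IHn] x /=.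
  by rewrite inE => /eqP ->; exists 0; rewrite mxE mulr0.
move=> /allpairsP [[y b] /= [/IHn [k Hk] _ ->]].
exists (k * (m n i)%:Z + b 0 i); rewrite !mxE mulrDr [X in _ + X]mulrC divfK; last first.
  by rewrite pnatr_eq0 -lt0n level_scale_gt0.
by rewrite /level_scale big_ord_recr natrM mulrAC Hk intrD intrM -pmulrn.
Qed.

Lemma echar_scalez_conv_points n l x : x \in conv_points R m Bs n ->
  echar (scalez (level_scale m n) l) x = 1.
Proof.
move=> xX; rewrite /echar /dotv -sumrN expi2pi_sum big1 // => i _.
have [k Hk] := conv_points_lattice i xX.
by rewrite !mxE intrM -pmulrn mulrAC Hk -intrM -mulrNz expi2pi_int.
Qed.

End DdSequence.

Lemma conv_points_unit_cube m Bs n : Dd_seq m Bs ->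
  {in conv_points R m Bs n, forall x, in_unit_cube x}.
Proof.
elim: n m Bs => [|n IHn] m Bs mBs_Dd x.
  by rewrite inE => /eqP -> i; rewrite mxE lexx ler01.
rewrite conv_pointsS => /allpairsP [[b y] /= [bB yX ->]] i; rewrite !mxE.
have /andP[y0 y1] := IHn _ _ (Dd_drop_levels 1 mBs_Dd) y yX i.
have /andP[b0 b1] := digits_in_box mBs_Dd bB i.
have m0 : 0 < (m 0%N i)%:R :> R.
  by rewrite ltr0n; case: (mBs_Dd 0%N) => + _ => /(_ i); exact: leq_trans.
have b0R : 0 <= (b 0 i)%:~R :> R by rewrite ler0z.
have b1R : (b 0 i)%:~R + 1 <= (m 0%N i)%:R :> R.
  by rewrite -[1]/(1%:~R) -intrD pmulrn ler_int -ltzD1 ltrD2r.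
by rewrite ler_pdivrMr // mul1r divr_ge0 ?(ltW m0) ?addr_ge0 //=; lra.
Qed.

End ConvolutionPoints.

(* [S] is a spectrum of the [n]-th finite convolution. *)
Definition conv_spectrum (R : realType) (d : nat) (m : nat -> 'I_d -> nat)
    (Bs : nat -> seq 'rV[int]_d) n (S : seq 'rV[int]_d) : Prop :=
  parseval (@echar R d) (conv_points R m Bs n) S.

Section SpectralTower.
Variables (R : realType) (d : nat).
Variables (m : nat -> 'I_d -> nat) (Bs : nat -> seq 'rV[int]_d).
Hypothesis mBs_Dd : Dd_seq m Bs.
Implicit Types (l : 'rV[int]_d) (S : seq 'rV[int]_d).

Local Notation scale n := (level_scale m n).
Local Notation conv_spectrum := (conv_spectrum R m Bs).

Lemma conv_spectrum0 : conv_spectrum 0 [:: 0].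
Proof.
move=> g; rewrite /mean /= !big_seq1 !invr1 !mul1r sqnormcM sqnormc_echar.
by rewrite mulr1.
Qed.

Lemma echar_scalez_digit n k b :
  echar (scalez (scale n) k) (scaled_digit R m n b) = Rinv_char R (m n) k b.
Proof.
have scaleS : scale n.+1 = (fun i => scale n i * m n i)%N.
  by apply/funext => i; rewrite /level_scale big_ord_recr.
rewrite scaled_digitE scaleS unscale_mul /echar -dotv_unscale unscale_scalez.
  by rewrite /Rinv_char Rinv_dotE.
exact: level_scale_gt0.
Qed.

Lemma conv_spectrumS n S : admissible R (m n) (Bs n) -> conv_spectrum n S ->
  exists2 S', conv_spectrum n.+1 S' & {subset S <= S'}.
Proof.
move=> /(admissible_parseval (size_digits_gt0 mBs_Dd n)) [L L_parseval L0] S_spec.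
exists [seq l + scalez (scale n) k | l <- S, k <- L]; last first.
  move=> l lS; apply/allpairsP; exists (l, 0); split => //=.
  by rewrite scalez0 addr0.
apply: (parseval_allpairs (w := fun l b => echar l (scaled_digit R m n b)) _ _ S_spec L_parseval).
  by move=> l b; exact: sqnormc_echar.
move=> l k b x xX; rewrite echarDl !echarDr echar_scalez_digit.
by rewrite (echar_scalez_conv_points mBs_Dd _ xX); ring.
Qed.

Lemma conv_spectrum_extend n k S : (forall j, admissible R (m j) (Bs j)) ->
  (n <= k)%N -> conv_spectrum n S ->
  exists2 S', conv_spectrum k S' & {subset S <= S'}.
Proof.
move=> adm /subnKC <-; elim: (k - n)%N => [|j IHj] S_spec; first by rewrite addn0; exists S.
have [S1 S1_spec SS1] := IHj S_spec; have [S2 S2_spec S12] := conv_spectrumS (adm _) S1_spec.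
by exists S2; rewrite ?addnS // => l /SS1 /S12.
Qed.

Lemma conv_spectrum_shift n S (f : 'rV[int]_d -> 'rV[int]_d) :
  conv_spectrum n S -> conv_spectrum n [seq l + scalez (scale n) (f l) | l <- S].
Proof.
apply: (parseval_map (w := fun=> 1)) => [x|l x xX]; first exact: sqnormc1.
by rewrite echarDl (echar_scalez_conv_points mBs_Dd _ xX) mulr1 mul1r.
Qed.

Definition tail_points n k : seq 'rV[R]_d :=
  conv_points R (drop_levels n m) (drop_levels n Bs) k.

Definition tail_energy n k l : R :=
  energy (tail_points n k) (unscale (scale n) (intrv R l)).

Lemma norm_unscale_tail_le n k y : y \in tail_points n k ->
  `|unscale (scale n) y| <= (2 ^+ n)^-1.
Proof.
move=> /(conv_points_unit_cube (Dd_drop_levels n mBs_Dd)) y1.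
apply: rV_norm_le => [|i]; first by rewrite invr_ge0 exprn_ge0.
have /andP[y_ge0 y_le1] := y1 i; rewrite mxE ger0_norm ?divr_ge0 //.
by apply: le_trans (level_scale_inv_le R mBs_Dd n i); rewrite ler_piMl ?invr_ge0.
Qed.

Lemma tail_energy_ge_quarter l :
  exists N : nat, forall n k, (N <= n)%N -> 4^-1 <= tail_energy n k l.
Proof.
pose c : R := \sum_i `|intrv R l 0 i|.
have c0 : 0 <= c by exact: sumr_ge0.
exists (Num.bound (8 * c)) => n k Nn.
have c_le : 8 * c <= 2 ^+ n.
  apply: ltW; apply: lt_le_trans (archi_boundP _) _; first by rewrite mulr_ge0.
  by rewrite -natrX ler_nat; exact: leq_trans Nn (ltnW (ltn_expl n _)).
apply: energy_ge_quarter => [|y yT].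
  exact: (size_conv_points_gt0 R (Dd_drop_levels n mBs_Dd)).
rewrite dotv_unscale; apply: le_trans (norm_dotv_le _ _) (_ : c * (2 ^+ n)^-1 <= _).
  by move=> i; exact: le_trans (norm_coord_le _ i) (norm_unscale_tail_le yT).
by rewrite ler_pdivrMr ?exprn_gt0 // ler_pdivlMl.
Qed.

End SpectralTower.

Section EquipositiveSequence.
Variables (R : realType) (d : nat).

Lemma exists_uniform_lower_bound (I : finType) (E : I -> nat -> R) (c : R) :
  (forall i n k, (n <= k)%N -> E i k <= E i n) -> (forall n, exists i, c <= E i n) ->
  exists i, forall n, c <= E i n.
Proof.
move=> E_anti E_ge; apply: contrapT => /forallNP no_i.
have E_lt i : exists n, E i n < c.
  by have /existsNP[n /negP] := no_i i; rewrite -ltNge; exists n.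
have [K EK] := choice E_lt.
have [i le_E] := E_ge (\max_j K j); move: le_E; apply/negP; rewrite -ltNge.
by apply: le_lt_trans (EK i); apply: E_anti; exact: leq_bigmax.
Qed.

(* One [eps] serves all the sequences starting with [(m0, B)]: only finitely many
   frequencies are ever needed, and they do not depend on what follows. *)
Lemma equipositive_sequence (m0 : 'I_d -> nat) (B : seq 'rV[int]_d) :
  (forall i, d < m0 i)%N -> (0 < size B)%N -> {in B, forall b, in_digit_box m0 b} ->
  exists2 eps : R, 0 < eps & forall m Bs, Dd_seq m Bs -> m 0%N = m0 -> perm_eq (Bs 0%N) B ->
    forall xi, exists k, forall n, eps <= energy (conv_points R m Bs n) (xi + intrv R k).
Proof.
move=> dm B0 Bm; have [eps eps0 [r Hr]] := equipositive_cells R dm B0 Bm.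
exists eps => // m Bs mBs_Dd m0E BE xi.
pose fl : 'rV[int]_d := \row_i Num.floor (xi 0 i); pose x := xi - intrv R fl.
have x1 : in_unit_cube x.
  move=> i; rewrite !mxE; have := floor_itv (xi 0 i); rewrite intrD => /andP[].
  by rewrite -[1%:~R]/1; lra.
pose E (f : {ffun 'I_d -> 'I_(r.*2.+1)}) n :=
  energy (conv_points R m Bs n.+1) (x + intrv R (kernel_freq f)).
have [f n k nk|n|f Hf] := @exists_uniform_lower_bound _ E eps.
- exact: energy_conv_points_mono.
- have tail1 := conv_points_unit_cube (R := R) (n := n) (Dd_drop_levels 1 mBs_Dd).
  have tail_gt0 := size_conv_points_gt0 R (Dd_drop_levels 1 mBs_Dd) n.
  have [f Hf] := Hr _ x tail_gt0 tail1 x1; exists f.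
  by rewrite /E conv_pointsS m0E (perm_energy _ (perm_allpairs _ BE (perm_refl _))).
exists (kernel_freq f - fl) => n; apply: le_trans (Hf n) _.
have -> : xi + intrv R (kernel_freq f - fl) = x + intrv R (kernel_freq f).
  by apply/rowP => i; rewrite !mxE intrB; ring.
exact: energy_conv_points_mono.
Qed.

End EquipositiveSequence.

Section TowerConstruction.
Variables (R : realType) (d : nat).
Variables (m : nat -> 'I_d -> nat) (Bs : nat -> seq 'rV[int]_d).
Hypothesis mBs_Dd : Dd_seq m Bs.

Local Notation conv_spectrum := (conv_spectrum R m Bs).

Definition energetic (eps : R) n (S : seq 'rV[int]_d) : Prop :=
  {in S, forall l k, eps <= tail_energy R m Bs n k l}.

Definition equipositive_level (eps : R) n : Prop := forall l, exists k, forall j,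
  eps <= tail_energy R m Bs n j (l + scalez (level_scale m n) k).

Definition spectral_tower (eps : R) (ns : nat -> nat) (S : nat -> seq 'rV[int]_d) : Prop :=
  forall j, [/\ (j <= ns j)%N, conv_spectrum (ns j) (S j), {subset S j <= S j.+1} &
    energetic eps (ns j) (S j)].

Lemma equipositive_tails (m0 : 'I_d -> nat) (B : seq 'rV[int]_d) :
  (forall i, d < m0 i)%N ->
  (forall N, exists n, [/\ (N <= n)%N, m n = m0 & perm_eq (Bs n) B]) ->
  exists2 eps : R, 0 < eps & forall N, exists2 n, (N <= n)%N & equipositive_level eps n.
Proof.
move=> dm recur; have [n0 [_ m0E BE]] := recur 0%N.
have [|b|eps eps0 Heps] := @equipositive_sequence R d m0 B dm.
- by rewrite -(perm_size BE) (size_digits_gt0 mBs_Dd).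
- by rewrite -(perm_mem BE) -m0E; exact: digits_in_box.
exists eps => // N; have [n [Nn mE BnE]] := recur N; exists n => // l.
have [||k Hk] := Heps _ _ (Dd_drop_levels n mBs_Dd) _ _
  (unscale (level_scale m n) (intrv R l)).
- by rewrite /drop_levels addn0.
- by rewrite /drop_levels addn0.
exists k => j; rewrite /tail_energy intrvD unscaleD unscale_scalez; first exact: Hk.
exact: level_scale_gt0 mBs_Dd _.
Qed.

Hypothesis mBs_admissible : forall n, admissible R (m n) (Bs n).

(* The old frequencies keep their places, being energetic at all late levels; the
   new ones are moved to energetic positions. *)
Lemma spectral_tower_step (eps : R) : eps <= 4^-1 ->
  (forall N, exists2 n, (N <= n)%N & equipositive_level eps n) ->
  forall n S, conv_spectrum n S ->
  exists n' S', [/\ (n < n')%N, conv_spectrum n' S', {subset S <= S'} & energetic eps n' S'].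
Proof.
move=> eps4 equi n S S_spec.
have [N HN] := choice (tail_energy_ge_quarter R mBs_Dd).
have [n' n'_ge Hn'] := equi (maxn n.+1 (\max_(l <- S) N l)).
have nn' : (n < n')%N by exact: leq_trans (leq_maxl _ _) n'_ge.
have [S1 S1_spec SS1] := conv_spectrum_extend mBs_Dd mBs_admissible (ltnW nn') S_spec.
have [kk Hkk] := choice Hn'; pose f l := if l \in S then 0 else kk l.
exists n', [seq l + scalez (level_scale m n') (f l) | l <- S1]; split => //.
- exact: conv_spectrum_shift.
- by move=> l lS; apply/mapP; exists l; [exact: SS1 | rewrite /f lS scalez0 addr0].
- move=> _ /mapP[l _ ->] k; rewrite /f; case: ifPn => [lS|_]; last exact: Hkk.
  rewrite scalez0 addr0 (le_trans eps4) // HN // (leq_trans _ n'_ge) //.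
  by rewrite leq_max (big_rem l) //= leq_maxl orbT.
Qed.

Lemma exists_spectral_tower (m0 : 'I_d -> nat) (B : seq 'rV[int]_d) :
  (forall i, d < m0 i)%N ->
  (forall N, exists n, [/\ (N <= n)%N, m n = m0 & perm_eq (Bs n) B]) ->
  exists2 eps : R, 0 < eps & exists ns S, spectral_tower eps ns S.
Proof.
move=> dm recur; have [e e0 He] := equipositive_tails dm recur.
pose eps := Num.min e 4^-1; exists eps; first by rewrite lt_min e0 invr_gt0 ltr0n.
have eps4 : eps <= 4^-1 by rewrite ge_min lexx orbT.
have equi N : exists2 n, (N <= n)%N & equipositive_level eps n.
  have [n Nn Hn] := He N; exists n => // l; have [k Hk] := Hn l; exists k => j.
  by rewrite (le_trans _ (Hk j)) // ge_min lexx.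
pose level := {p : nat * seq 'rV[int]_d | conv_spectrum p.1 p.2}.
pose next (p q : level) := [/\ ((sval p).1 < (sval q).1)%N,
  {subset (sval p).2 <= (sval q).2} & energetic eps (sval q).1 (sval q).2].
have step (p : level) : {q : level | next p q}.
  apply: cid; case: p => [[n S] S_spec].
  have [n' [S' [nn' S_spec' SS' eS']]] := spectral_tower_step eps4 equi S_spec.
  by exists (exist _ (n', S') S_spec').
pose start : level := exist _ (0%N, [:: 0]) (@conv_spectrum0 R d m Bs).
have [t [_ Ht]] := dependent_choice step start.
exists (fun j => (sval (t j.+1)).1), (fun j => (sval (t j.+1)).2) => j; split.
- by elim: j => // j IHj; apply: leq_ltn_trans IHj _; case: (Ht j.+1).
- exact: (svalP (t j.+1)).
- by case: (Ht j.+1).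
- by case: (Ht j).
Qed.

End TowerConstruction.

(** * Density of bounded Lipschitz functions *)

Section BoundedLipschitz.
Variables (R : realType) (V : normedModType R).
Implicit Types (g h : V -> R).

Definition bounded_lipschitz g : Prop :=
  (exists K, forall x y, `|g x - g y| <= K * `|x - y|) /\
  (exists M, forall x, `|g x| <= M).

Lemma lipschitz_continuous g :
  (exists K, forall x y, `|g x - g y| <= K * `|x - y|) -> continuous g.
Proof.
move=> [K HK] x; apply/(@cvgrPdist_lt _ _ _ (nbhs x)) => e e0.
have K0 : 0 < `|K| + 1 by rewrite ltr_wpDl.
apply/nbhs_ballP; exists (e / (`|K| + 1)); first by rewrite /= divr_gt0.
move=> y; rewrite -ball_normE /= ltr_pdivlMr // => xy.
apply: le_lt_trans (HK x y) _; apply: le_lt_trans xy.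
by rewrite mulrC ler_wpM2l // (le_trans (ler_norm _)) // lerDl.
Qed.

Lemma bounded_lipschitz_cst (c : R) : bounded_lipschitz (fun=> c).
Proof. by split; [exists 0 => x y; rewrite subrr normr0 mul0r | exists `|c|]. Qed.

Lemma bounded_lipschitzD g h : bounded_lipschitz g -> bounded_lipschitz h ->
  bounded_lipschitz (fun x => g x + h x).
Proof.
move=> [[K HK] [M HM]] [[L HL] [N HN]]; split.
  exists (K + L) => x y; rewrite opprD addrACA mulrDl.
  exact: le_trans (ler_normD _ _) (lerD _ _).
by exists (M + N) => x; exact: le_trans (ler_normD _ _) (lerD _ _).
Qed.

Lemma bounded_lipschitzZ c g : bounded_lipschitz g -> bounded_lipschitz (fun x => c * g x).
Proof.
move=> [[K HK] [M HM]]; split.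
  by exists (`|c| * K) => x y; rewrite -mulrBr normrM -mulrA ler_wpM2l.
by exists (`|c| * M) => x; rewrite normrM ler_wpM2l.
Qed.

Section DistanceToSet.
Variable A : set V.
Hypothesis A_neq0 : A !=set0.

Definition dist_to x : R := inf [set `|x - z| | z in A].

Lemma dist_to_le x z : A z -> dist_to x <= `|x - z|.
Proof.
by move=> Az; apply: inf_lbound; [exists 0 => _ [y _ <-] | exists z].
Qed.

Lemma dist_to_ge x e : (forall z, A z -> e <= `|x - z|) -> e <= dist_to x.
Proof.
move=> e_le; apply: lb_le_inf => [|_ [z Az <-]]; last exact: e_le.
by have [z Az] := A_neq0; exists `|x - z|, z.
Qed.

Lemma dist_to_ge0 x : 0 <= dist_to x.
Proof. exact: dist_to_ge. Qed.

Lemma dist_to_mem x : A x -> dist_to x = 0.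
Proof.
by move=> Ax; apply/eqP; rewrite eq_le dist_to_ge0 (le_trans (dist_to_le x Ax)) // subrr normr0.
Qed.

Lemma dist_to_open_gt0 x : open (~` A) -> ~ A x -> 0 < dist_to x.
Proof.
rewrite openE => oA nAx; have /nbhs_ballP [e /= e0 He] := oA x nAx.
apply: lt_le_trans e0 (dist_to_ge _) => z Az; rewrite leNgt; apply/negP => xz.
by apply: (He z) Az; rewrite -ball_normE.
Qed.

Lemma dist_to_lipschitz x y : `|dist_to x - dist_to y| <= `|x - y|.
Proof.
have half u v : dist_to u - dist_to v <= `|u - v|.
  rewrite lerBlDr -lerBlDl; apply: dist_to_ge => z Az.
  rewrite lerBlDl (le_trans (dist_to_le u Az)) //.
  by rewrite -[u - z](subrKA v) ler_normD.
by rewrite ler_norml half andbT lerNl opprB distrC half.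
Qed.

Lemma bounded_lipschitz_min_dist (k : R) : 0 <= k ->
  bounded_lipschitz (fun x => Num.min 1 (k * dist_to x)).
Proof.
move=> k0; split.
  exists k => x y; apply: (@le_trans _ _ `|k * dist_to x - k * dist_to y|).
    move: (k * dist_to x) (k * dist_to y) => a b.
    rewrite /Num.min ler_norml; have := ler_norm (a - b); have := ler_norm (b - a).
    by rewrite distrC; case: ifP; case: ifP; lra.
  by rewrite -mulrBr normrM ger0_norm // ler_wpM2l // dist_to_lipschitz.
exists 1 => x; rewrite ger0_norm ?ge_min ?lexx //.
by rewrite le_min ler01 mulr_ge0 // dist_to_ge0.
Qed.

End DistanceToSet.

End BoundedLipschitz.

Section Density.
Variables (R : realType) (V : normedModType R).
Local Notation T := (g_sigma_algebraType (@open V)).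
Variable mu : {finite_measure set T -> \bar R}.
Implicit Types f g h : T -> R.

Lemma open_measurable_borel (U : set V) : open U -> measurable (U : set T).
Proof. by move=> oU; exact: sub_sigma_algebra. Qed.

Lemma continuous_measurable_borel (g : V -> R) : continuous g ->
  measurable_fun setT (g : T -> R).
Proof.
move=> /continuousP cg; apply: (measurability (RGenOInfty.G (R := R))).
  exact: RGenOInfty.measurableE.
move=> _ [_ [a ->] <-]; rewrite setTI; apply: open_measurable_borel.
exact/cg/interval_open.
Qed.

Lemma bounded_lipschitz_measurable (g : V -> R) : bounded_lipschitz g ->
  measurable_fun setT (g : T -> R).
Proof. by move=> [/lipschitz_continuous/continuous_measurable_borel]. Qed.

Definition sqdist f g : \bar R := (\int[mu]_x ((f x - g x) ^+ 2)%:E)%E.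

Lemma sqdist_ge0 f g : (0 <= sqdist f g)%E.
Proof. by apply: integral_ge0 => x _; rewrite lee_fin sqr_ge0. Qed.

Lemma measurable_sqdist f g : measurable_fun setT f -> measurable_fun setT g ->
  measurable_fun setT (fun x => ((f x - g x) ^+ 2)%:E).
Proof.
by move=> mf mg; apply/measurable_EFinP; apply: measurable_funX; exact: measurable_funB.
Qed.

Lemma sqdist_lt_quarters f g f1 g1 f2 g2 (eta : R) :
  measurable_fun setT f -> measurable_fun setT g ->
  measurable_fun setT f1 -> measurable_fun setT g1 ->
  measurable_fun setT f2 -> measurable_fun setT g2 ->
  (forall x, f x - g x = (f1 x - g1 x) + (f2 x - g2 x)) ->
  (sqdist f1 g1 < (eta / 4)%:E)%E -> (sqdist f2 g2 < (eta / 4)%:E)%E ->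
  (sqdist f g < eta%:E)%E.
Proof.
move=> mf mg mf1 mg1 mf2 mg2 fgE lt1 lt2.
apply: (@le_lt_trans _ _ (2%:E * sqdist f1 g1 + 2%:E * sqdist f2 g2)%E); last first.
  rewrite (_ : eta%:E = (2%:E * (eta / 4)%:E + 2%:E * (eta / 4)%:E)%E).
    by apply: lteD; rewrite lte_pmul2l.
  by rewrite -!EFinM -EFinD; congr EFin; field.
have ge0 (u v : T -> R) x : (0 <= ((u x - v x) ^+ 2)%:E)%E by rewrite lee_fin sqr_ge0.
have ge0_2 (u v : T -> R) x : (0 <= 2%:E * ((u x - v x) ^+ 2)%:E)%E by rewrite mule_ge0.
have m1 := measurable_funeM 2%:E (measurable_sqdist mf1 mg1).
have m2 := measurable_funeM 2%:E (measurable_sqdist mf2 mg2).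
have int2 (u v : T -> R) : measurable_fun setT u -> measurable_fun setT v ->
    (2%:E * sqdist u v = \int[mu]_x (2%:E * ((u x - v x) ^+ 2)%:E))%E.
  by move=> meas_u meas_v; rewrite ge0_integralZl_EFin //; exact: measurable_sqdist.
rewrite !int2 // -ge0_integralD //; apply: ge0_le_integral => //.
- exact: measurable_sqdist.
- exact: emeasurable_funD.
move=> x _; rewrite -!EFinM -EFinD lee_fin fgE.
by have := sqr_ge0 (f1 x - g1 x - (f2 x - g2 x)); nra.
Qed.

Definition approximable f : Prop := measurable_fun setT f /\
  forall eta : R, 0 < eta ->
    exists2 g : V -> R, bounded_lipschitz g & (sqdist f g < eta%:E)%E.

Lemma approximable_bounded_lipschitz (g : V -> R) : bounded_lipschitz g -> approximable g.
Proof.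
move=> Hg; split=> [|eta eta0]; first exact: bounded_lipschitz_measurable.
exists g => //; rewrite /sqdist integral0_eq ?lte_fin // => x _.
by rewrite subrr expr0n.
Qed.

Lemma approximable_cst (c : R) : approximable (fun=> c).
Proof. exact/approximable_bounded_lipschitz/bounded_lipschitz_cst. Qed.

Lemma approximable_closed f : measurable_fun setT f ->
  (forall eta : R, 0 < eta -> exists2 h, approximable h & (sqdist f h < eta%:E)%E) ->
  approximable f.
Proof.
move=> mf near_f; split=> // eta eta0; have eta4 : 0 < eta / 4 by rewrite divr_gt0.
have [h [mh Hh] fh] := near_f _ eta4; have [g Hg hg] := Hh _ eta4.
exists g => //; have mg := bounded_lipschitz_measurable Hg.
by apply: (sqdist_lt_quarters mf mg mf mh mh mg _ fh hg) => x; rewrite addrA subrK.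
Qed.

Lemma approximableD f h : approximable f -> approximable h ->
  approximable (fun x => f x + h x).
Proof.
move=> [mf Hf] [mh Hh]; split=> [|eta eta0]; first exact: measurable_funD.
have eta4 : 0 < eta / 4 by rewrite divr_gt0.
have [g Hg fg] := Hf _ eta4; have [k Hk hk] := Hh _ eta4.
exists (fun x => g x + k x); first exact: bounded_lipschitzD.
have mg := bounded_lipschitz_measurable Hg; have mk := bounded_lipschitz_measurable Hk.
apply: (sqdist_lt_quarters _ _ mf mg mh mk _ fg hk) => [||x]; last by ring.
  exact: measurable_funD.
exact: measurable_funD.
Qed.

Lemma approximableZ c f : approximable f -> approximable (fun x => c * f x).
Proof.
move=> [mf Hf]; split=> [|eta eta0]; first exact: measurable_funM.
have c0 : 0 < c ^+ 2 + 1 by rewrite ltr_wpDl ?sqr_ge0.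
have [g Hg fg] := Hf (eta / (c ^+ 2 + 1)) (divr_gt0 eta0 c0).
exists (fun x => c * g x); first exact: bounded_lipschitzZ.
have -> : sqdist (fun x => c * f x) (fun x => c * g x) = ((c ^+ 2)%:E * sqdist f g)%E.
  rewrite /sqdist -ge0_integralZl_EFin ?sqr_ge0 //.
  - by apply: eq_integral => x _; rewrite -EFinM; congr EFin; ring.
  - by move=> x _; rewrite lee_fin sqr_ge0.
  - exact: measurable_sqdist mf (bounded_lipschitz_measurable Hg).
apply: (@le_lt_trans _ _ ((c ^+ 2 + 1)%:E * sqdist f g)%E).
  by rewrite lee_wpmul2r ?sqdist_ge0 // lee_fin lerDl.
have -> : eta%:E = ((c ^+ 2 + 1)%:E * (eta / (c ^+ 2 + 1))%:E)%E.
  by rewrite -EFinM mulrC divfK // gt_eqF.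
by rewrite lte_pmul2l.
Qed.

Lemma approximable_sum (I : Type) (r : seq I) (F : I -> T -> R) :
  (forall i, approximable (F i)) -> approximable (fun x => \sum_(i <- r) F i x).
Proof.
move=> HF; elim: r => [|i r IHr].
  by under eq_fun do rewrite big_nil; exact: approximable_cst.
by under eq_fun do rewrite big_cons; exact: approximableD.
Qed.

Lemma approximable_dominated_cvg f (h_ : nat -> T -> R) (G : T -> R) :
  measurable_fun setT f -> (forall n, approximable (h_ n)) ->
  mu.-integrable setT (EFin \o G) ->
  (forall n x, (f x - h_ n x) ^+ 2 <= G x) ->
  (forall x, h_ n x @[n --> \oo] --> f x) -> approximable f.
Proof.
move=> mf Hh iG dom cv; apply: approximable_closed => // eta eta0.
have : (sqdist f (h_ n))%E @[n --> \oo] --> (\int[mu]_x (cst 0%E x))%E.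
  apply: (@dominated_cvg _ _ _ mu setT measurableT
    (fun n x => ((f x - h_ n x) ^+ 2)%:E) (cst 0%E) (EFin \o G)) => //.
  - by move=> n; apply: measurable_sqdist => //; case: (Hh n).
  - move=> x _; apply/fine_cvgP; split; first by near=> n.
    suff : ((f x - h_ n x) ^+ 2) @[n --> \oo] --> (f x - f x) * (f x - f x).
      by rewrite subrr mulr0.
    by apply: cvgM; apply: cvgB => //; exact: cvg_cst.
  - by move=> n x _; rewrite /= lee_fin ger0_norm ?sqr_ge0 // dom.
rewrite integral0 => /fine_cvgP [fin /cvgrPdist_lt/(_ eta eta0) cv0].
near \oo => n; exists (h_ n) => //.
have fn : sqdist f (h_ n) \is a fin_num by near: n.
rewrite -(fineK fn) lte_fin.
have : `|0 - fine (sqdist f (h_ n))| < eta by near: n.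
by rewrite sub0r normrN => /(le_lt_trans (ler_norm _)).
Unshelve. all: by end_near. Qed.

Lemma approximable_indic_cvg (A : set T) (h_ : nat -> T -> R) : measurable A ->
  (forall n, approximable (h_ n)) -> (forall n x, 0 <= h_ n x <= 1) ->
  (forall x, \forall n \near \oo, h_ n x = \1_A x) -> approximable (\1_A : T -> R).
Proof.
move=> mA Hh h01 cv; apply: (@approximable_dominated_cvg _ h_ (fun=> 1)) => //.
- exact: finite_measure_integrable_cst.
- move=> n x; have /andP[] := h01 n x; rewrite indicE.
  by case: (x \in A) => /=; nra.
- by move=> x; exact: cvg_near_cst.
Qed.

Lemma approximable_indic_open (U : set V) : open U -> approximable (\1_(U : set T) : T -> R).
Proof.
move=> oU; have [A0|] := pselect (~` U !=set0); last first.
  move=> /nonemptyPn/(congr1 setC); rewrite setCK setC0 => ->.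
  rewrite (_ : \1__ = fun=> 1); first exact: approximable_cst.
  by apply/funext => x; rewrite indicE in_setT.
pose h n x : R := Num.min 1 (n%:R * dist_to (~` U) x).
apply: (@approximable_indic_cvg _ h) => [|n|n x|x].
- exact: open_measurable_borel.
- exact/approximable_bounded_lipschitz/bounded_lipschitz_min_dist.
- by rewrite /h le_min ler01 mulr_ge0 ?dist_to_ge0 //= ge_min lexx.
rewrite indicE; have [Ux|nUx] := pselect (U x); last first.
  by near=> n; rewrite memNset // /h dist_to_mem // mulr0; apply/eqP; rewrite eq_minr.
have d0 : 0 < dist_to (~` U) x by apply: dist_to_open_gt0; rewrite ?setCK.
near=> n; rewrite mem_set // /h; apply/eqP; rewrite eq_minl // -ler_pdivrMr //.
by near: n; exact: nbhs_infty_ger.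
Unshelve. all: by end_near. Qed.

Lemma lambda_system_approximable_indic :
  lambda_system setT [set B : set T | measurable B /\ approximable (\1_B : T -> R)].
Proof.
split => //.
- split; first exact: measurableT.
  rewrite (_ : \1__ = fun=> 1); first exact: approximable_cst.
  by apply/funext => x; rewrite indicE in_setT.
- move=> B C CB [mB aB] [mC aC]; split; first exact: measurableD.
  rewrite (_ : \1__ = fun x => \1_B x + -1 * \1_C x).
    by apply: approximableD => //; exact: approximableZ.
  apply/funext => x; rewrite !indicE in_setD.
  have [xC|] := boolP (x \in C); last by rewrite andbT mulr0 addr0.
  by rewrite andbF /= mulr1 (_ : x \in B) ?subrr //; move: xC; rewrite !inE => /CB.
- move=> F ndF HF; have mF : measurable (\bigcup_i F i : set T).
    by apply: bigcupT_measurable => i; case: (HF i).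
  split => //; apply: (@approximable_indic_cvg _ (fun n => \1_(F n : set T))) => //.
  + by move=> n; case: (HF n).
  + by move=> n x; rewrite indicE; case: (_ \in _); rewrite /= ?ler01 ?lexx.
  move=> x; rewrite !indicE; have [[k _ Fkx]|nx] := pselect ((\bigcup_i F i) x).
    near=> n; have /ndF/subsetPset kn : (k <= n)%N by near: n; exact: nbhs_infty_ge.
    by rewrite indicE !mem_set //; [exists k | exact: kn].
  by near=> n; rewrite indicE !memNset // => Fnx; apply: nx; exists n.
Unshelve. all: by end_near. Qed.

Lemma approximable_indic (A : set T) : measurable A -> approximable (\1_A : T -> R).
Proof.
suff sub : (<<s @open V >> : set (set T)) `<=`
    [set B : set T | measurable B /\ approximable (\1_B : T -> R)] by move=> /sub [].
apply: (@lambda_system_subset _ (@open V) _ setT _ lambda_system_approximable_indic) => //.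
  by move=> B C; exact: openI.
by move=> U oU; split; [exact: open_measurable_borel | exact: approximable_indic_open].
Qed.

Import HBNNSimple.

Lemma approximable_nnsfun (h : {nnsfun T >-> R}) : approximable h.
Proof.
rewrite (_ : (h : T -> R) = fun x =>
  \sum_(y <- finmap.enum_fset (fset_set (range h))) y * \1_(h @^-1` [set y]) x).
  apply: approximable_sum => y; apply/approximableZ/approximable_indic.
  exact: measurable_funPTI.
by apply/funext => x; rewrite -fsbig_finite // -fimfunE.
Qed.

Lemma approximable_ge0 f : measurable_fun setT f -> (forall x, 0 <= f x) ->
  mu.-integrable setT (EFin \o (fun x => f x ^+ 2)) -> approximable f.
Proof.
move=> mf f0 if2; have mEf : measurable_fun setT (EFin \o f) by exact/measurable_EFinP.
pose h n : T -> R := nnsfun_approx measurableT mEf n.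
have h_cvg x : h n x @[n --> \oo] --> f x.
  have := @cvg_nnsfun_approx _ _ _ setT measurableT _ mEf
    (fun x _ => f0 x : (0 <= (f x)%:E)%E) x I.
  by move=> /fine_cvgP [_].
have h_itv n x : 0 <= h n x <= f x.
  rewrite fun_ge0 /=.
  have h_nd : nondecreasing_seq (h^~ x).
    by move=> i j ij; have /lefP := nd_nnsfun_approx measurableT mEf ij; exact.
  by have := nondecreasing_cvgn_le h_nd (cvgP _ (h_cvg x)) n; rewrite (cvg_lim _ (h_cvg x)).
apply: (approximable_dominated_cvg mf _ if2 _ h_cvg) => [n|n x].
  exact: approximable_nnsfun.
by have /andP[] := h_itv n x; nra.
Qed.

Lemma approximable_L2 f : measurable_fun setT f ->
  mu.-integrable setT (EFin \o (fun x => f x ^+ 2)) -> approximable f.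
Proof.
move=> mf if2.
have part g : measurable_fun setT g -> (forall x, 0 <= g x <= `|f x|) -> approximable g.
  move=> mg g_itv; apply: approximable_ge0 => // [x|]; first by case/andP: (g_itv x).
  apply: le_integrable if2 => // [|x _].
    by apply/measurable_EFinP; exact: measurable_funX.
  rewrite /= lee_fin !ger0_norm ?sqr_ge0 // -(real_normK (num_real (f x))).
  by have /andP[] := g_itv x; have := normr_ge0 (f x); nra.
rewrite (_ : f = fun x => f^\+ x + -1 * f^\- x); last first.
  by apply/funext => x; rewrite mulN1r -[in LHS](funrposBneg f).
apply: approximableD; last apply: approximableZ; apply: part.
- exact: measurable_funrpos.
- by move=> x; rewrite /funrpos le_max lexx orbT ge_max ler_norm normr_ge0.
- exact: measurable_funrneg.
- by move=> x; rewrite /funrneg le_max lexx orbT ge_max -normrN ler_norm normr_ge0.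
Qed.

Lemma exists_bounded_lipschitz_near f (eta : R) : measurable_fun setT f ->
  mu.-integrable setT (EFin \o (fun x => f x ^+ 2)) -> 0 < eta ->
  exists2 g : V -> R, bounded_lipschitz g & Rintegral mu setT (fun x => (f x - g x) ^+ 2) <= eta.
Proof.
move=> mf if2 /(approximable_L2 mf if2).2 [g Hg fg]; exists g => //.
rewrite /Rintegral -lee_fin fineK; first exact: ltW.
by rewrite ge0_fin_numE ?sqdist_ge0 // (lt_trans fg) // ltry.
Qed.

End Density.

(** * Square-integrable complex functions *)

Section ComplexMeasurable.
Variables (R : realType) (disp : measure_display) (T : measurableType disp).
Implicit Types (g h : T -> R[i]) (c : R[i]).

Definition cmeasurable g : Prop :=
  measurable_fun setT (fun x => Re (g x)) /\ measurable_fun setT (fun x => Im (g x)).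

Lemma cmeasurableD g h : cmeasurable g -> cmeasurable h -> cmeasurable (fun x => g x + h x).
Proof.
move=> [g1 g2] [h1 h2]; split; under eq_fun do rewrite raddfD; exact: measurable_funD.
Qed.

Lemma cmeasurableM g h : cmeasurable g -> cmeasurable h -> cmeasurable (fun x => g x * h x).
Proof.
move=> [g1 g2] [h1 h2]; split.
  by under eq_fun do rewrite ReM; apply: measurable_funB; exact: measurable_funM.
by under eq_fun do rewrite ImM; apply: measurable_funD; exact: measurable_funM.
Qed.

Lemma cmeasurable_cst c : cmeasurable (fun=> c).
Proof. by split; exact: measurable_cst. Qed.

Lemma cmeasurable_conj g : cmeasurable g -> cmeasurable (fun x => conjc (g x)).
Proof.
have ReJ (z : R[i]) : Re (conjc z) = Re z by case: z.
have ImJ (z : R[i]) : Im (conjc z) = - Im z by case: z.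
move=> [g1 g2]; split; first by under eq_fun do rewrite ReJ.
by under eq_fun do rewrite ImJ; exact: measurableT_comp.
Qed.

Lemma cmeasurable_sqnormc g : cmeasurable g -> measurable_fun setT (fun x => sqnormc (g x)).
Proof. by move=> [g1 g2]; apply: measurable_funD; exact: measurable_funX. Qed.

Lemma integrable_le (mu : {measure set T -> \bar R}) (u v : T -> R) :
  measurable_fun setT u -> (forall x, `|u x| <= v x) ->
  mu.-integrable setT (EFin \o v) -> mu.-integrable setT (EFin \o u).
Proof.
move=> meas_u uv; apply: le_integrable => // [|x _]; first exact/measurable_EFinP.
by rewrite /= lee_fin (le_trans (uv x)) // ler_norm.
Qed.

End ComplexMeasurable.

Section SquareIntegrable.
Variables (R : realType) (d : nat) (mu : probability (Rd R d) R).
Implicit Types (f g h : Rd R d -> R[i]) (c : R[i]).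

Lemma L2P g : L2 mu g <->
  cmeasurable g /\ mu.-integrable setT (EFin \o (fun x => sqnormc (g x))).
Proof. by split=> [[g1 [g2 ig]] | [[g1 g2] ig]]. Qed.

Lemma L2_sqr_integrable g : L2 mu g ->
  mu.-integrable setT (EFin \o (fun x => Re (g x) ^+ 2)) /\
  mu.-integrable setT (EFin \o (fun x => Im (g x) ^+ 2)).
Proof.
move=> /L2P[[g1 g2] ig]; split; apply: integrable_le ig.
- exact: measurable_funX.
- by move=> x; rewrite ger0_norm ?sqr_ge0 // sqr_Re_le.
- exact: measurable_funX.
- by move=> x; rewrite ger0_norm ?sqr_ge0 // sqr_Im_le.
Qed.

Lemma L2_dominated g (v : Rd R d -> R) : cmeasurable g -> (forall x, sqnormc (g x) <= v x) ->
  mu.-integrable setT (EFin \o v) -> L2 mu g.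
Proof.
move=> mg gv iv; apply/L2P; split=> //; apply: integrable_le iv => [|x].
  exact: cmeasurable_sqnormc.
by rewrite ger0_norm ?sqnormc_ge0.
Qed.

Lemma L2_bounded g (M : R) : cmeasurable g -> (forall x, sqnormc (g x) <= M) -> L2 mu g.
Proof. by move=> mg gM; apply: (L2_dominated mg gM); exact: finite_measure_integrable_cst. Qed.

Lemma L2D g h : L2 mu g -> L2 mu h -> L2 mu (fun x => g x + h x).
Proof.
move=> /L2P[mg ig] /L2P[mh ih].
apply: (L2_dominated (cmeasurableD mg mh) (fun x => sqnormcD_le (g x) (h x))).
exact: (integrableZl measurableT 2 (integrableD measurableT ig ih)).
Qed.

Lemma L2Z c g : L2 mu g -> L2 mu (fun x => c * g x).
Proof.
move=> /L2P[mg ig].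
apply: (L2_dominated (v := fun x => sqnormc c * sqnormc (g x))) => [|x|].
- by apply: cmeasurableM => //; exact: cmeasurable_cst.
- by rewrite sqnormcM.
- exact: (integrableZl measurableT _ ig).
Qed.

Lemma L2B g h : L2 mu g -> L2 mu h -> L2 mu (fun x => g x - h x).
Proof. by move=> Lg /(L2Z (-1)); under eq_fun do rewrite mulN1r; exact: L2D. Qed.

Lemma L2_sum (I : Type) (r : seq I) (F : I -> Rd R d -> R[i]) :
  (forall i, L2 mu (F i)) -> L2 mu (fun x => \sum_(i <- r) F i x).
Proof.
move=> LF; elim: r => [|i r IHr].
  under eq_fun do rewrite big_nil; apply: (@L2_bounded _ 0) => [|x].
    exact: cmeasurable_cst.
  by rewrite sqnormc_real expr0n.
by under eq_fun do rewrite big_cons; exact: L2D.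
Qed.

Lemma L2_conj g : L2 mu g -> L2 mu (fun x => conjc (g x)).
Proof.
move=> /L2P[mg ig]; apply: (L2_dominated (cmeasurable_conj mg) _ ig) => x.
by rewrite sqnormc_conj.
Qed.

Definition cintegrable g : Prop :=
  mu.-integrable setT (EFin \o (fun x => Re (g x))) /\
  mu.-integrable setT (EFin \o (fun x => Im (g x))).

Lemma L2M_cintegrable g h : L2 mu g -> L2 mu h -> cintegrable (fun x => g x * h x).
Proof.
move=> /L2P[mg ig] /L2P[mh ih]; have [m1 m2] := cmeasurableM mg mh.
have igh := integrableD measurableT ig ih.
have abs_le (a : R) x : a ^+ 2 <= sqnormc (g x * h x) -> `|a| <= sqnormc (g x) + sqnormc (h x).
  move=> a_le; have gh0 : 0 <= sqnormc (g x) + sqnormc (h x) by rewrite addr_ge0 ?sqnormc_ge0.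
  rewrite -(ler_pXn2r (ltn0Sn 1)) ?nnegrE // real_normK ?num_real //.
  apply: le_trans a_le _; rewrite sqnormcM.
  by have := sqnormc_ge0 (g x); have := sqnormc_ge0 (h x); nra.
split; apply: integrable_le igh => // x; apply: abs_le.
  exact: sqr_Re_le.
exact: sqr_Im_le.
Qed.

Lemma cintegralD g h : cintegrable g -> cintegrable h ->
  cintegral mu (fun x => g x + h x) = cintegral mu g + cintegral mu h.
Proof.
move=> [g1 g2] [h1 h2]; rewrite /cintegral.
under eq_fun do rewrite raddfD; under [X in (_ +i* Rintegral _ _ X)%C]eq_fun do rewrite raddfD.
by rewrite !RintegralD.
Qed.

Lemma cintegralZ c g : cintegrable g ->
  cintegral mu (fun x => c * g x) = c * cintegral mu g.
Proof.
move=> [g1 g2]; have g1Z a := integrableZl measurableT a g1.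
have g2Z a := integrableZl measurableT a g2.
apply/eqP; rewrite eq_complex ReM ImM /=; apply/andP; split; apply/eqP.
  under eq_fun do rewrite ReM.
  by rewrite RintegralB ?RintegralZl //; [exact: g1Z | exact: g2Z].
under eq_fun do rewrite ImM.
by rewrite RintegralD ?RintegralZl //; [exact: g2Z | exact: g1Z].
Qed.

Lemma cintegral_conj g : cintegrable g ->
  cintegral mu (fun x => conjc (g x)) = conjc (cintegral mu g).
Proof.
move=> [g1 g2]; rewrite /cintegral /=; congr (_ +i* _)%C.
  by apply: eq_Rintegral => x _; case: (g x).
rewrite -mulN1r -RintegralZl //; apply: eq_Rintegral => x _.
by rewrite mulN1r; case: (g x).
Qed.

Definition L2sq g : R := Rintegral mu setT (fun x => sqnormc (g x)).

Lemma L2sq_ge0 g : 0 <= L2sq g.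
Proof. by apply: Rintegral_ge0 => x _; exact: sqnormc_ge0. Qed.

Lemma L2sqD_le g h : L2 mu g -> L2 mu h -> L2sq (fun x => g x + h x) <= 2 * (L2sq g + L2sq h).
Proof.
move=> Lg Lh; have /L2P[_ igh] := L2D Lg Lh; have /L2P[_ ig] := Lg; have /L2P[_ ih] := Lh.
have igh2 := integrableD measurableT ig ih.
rewrite /L2sq -RintegralD // -RintegralZl //.
apply: le_Rintegral => // [|x _]; first exact: (integrableZl measurableT 2 igh2).
exact: sqnormcD_le.
Qed.

Lemma L2sq_eq0_ae g : L2 mu g -> L2sq g = 0 -> {ae mu, forall x, g x = 0}.
Proof.
move=> /L2P[_ ig] g0.
have : (\int[mu]_x `|(sqnormc (g x))%:E| = 0)%E.
  under eq_integral do rewrite gee0_abs ?lee_fin ?sqnormc_ge0 //.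
  by rewrite -[LHS]fineK ?(integrable_fin_num measurableT ig) //; exact: (congr1 EFin g0).
move/(ae_eq_integral_abs mu measurableT (measurable_int mu ig)).
by apply: filterS => x /(_ I) /= [] /eqP; rewrite sqnormc_eq0 => /eqP.
Qed.

Lemma innerDl f g h : L2 mu f -> L2 mu g -> L2 mu h ->
  inner mu (fun x => f x + g x) h = inner mu f h + inner mu g h.
Proof.
move=> Lf Lg Lh; have Lhc := L2_conj Lh.
rewrite /inner -cintegralD; [|exact: L2M_cintegrable..].
by congr cintegral; apply/funext => x; rewrite mulrDl.
Qed.

Lemma innerZl c f h : L2 mu f -> L2 mu h -> inner mu (fun x => c * f x) h = c * inner mu f h.
Proof.
move=> Lf Lh; rewrite /inner -cintegralZ; last exact: L2M_cintegrable (L2_conj Lh).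
by congr cintegral; apply/funext => x; rewrite mulrA.
Qed.

Lemma innerBl f g h : L2 mu f -> L2 mu g -> L2 mu h ->
  inner mu (fun x => f x - g x) h = inner mu f h - inner mu g h.
Proof.
move=> Lf Lg Lh; rewrite -[in RHS]mulN1r -innerZl // -innerDl //; last exact: L2Z.
by congr inner; apply/funext => x; rewrite mulN1r.
Qed.

Lemma innerC f g : L2 mu f -> L2 mu g -> inner mu g f = conjc (inner mu f g).
Proof.
move=> Lf Lg; rewrite /inner -cintegral_conj; last exact: L2M_cintegrable (L2_conj Lg).
by congr cintegral; apply/funext => x; rewrite rmorphM /= conjcK mulrC.
Qed.

Lemma inner_self f : inner mu f f = (L2sq f)%:C.
Proof.
rewrite /inner; under eq_fun do rewrite mulc_conj.
by rewrite /cintegral /= Rintegral_cst // mul0r.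
Qed.

Lemma inner_suml (I : Type) (r : seq I) (c : I -> R[i]) (F : I -> Rd R d -> R[i]) h :
  (forall i, L2 mu (F i)) -> L2 mu h ->
  inner mu (fun x => \sum_(i <- r) c i * F i x) h = \sum_(i <- r) c i * inner mu (F i) h.
Proof.
move=> LF Lh; elim: r => [|i r IHr].
  rewrite big_nil /inner; under eq_fun do rewrite big_nil mul0r.
  by rewrite /cintegral /= Rintegral_cst // mul0r.
rewrite big_cons -IHr -innerZl // -innerDl //; first last.
- by apply: L2_sum => j; exact: L2Z.
- exact: L2Z.
by congr inner; apply/funext => x; rewrite big_cons.
Qed.

Lemma bessel (I : eqType) (S : seq I) (e : I -> Rd R d -> R[i]) f :
  uniq S -> (forall i, L2 mu (e i)) -> L2 mu f ->
  {in S &, forall i j, inner mu (e i) (e j) = (i == j)%:R} ->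
  \sum_(i <- S) sqnormc (inner mu f (e i)) <= L2sq f.
Proof.
move=> uS Le Lf orth; pose c i := inner mu f (e i).
pose p x := \sum_(i <- S) c i * e i x; pose s := \sum_(i <- S) sqnormc (c i).
have Lp : L2 mu p by apply: L2_sum => i; exact: L2Z.
have inner_pe i : i \in S -> inner mu p (e i) = c i.
  move=> iS; rewrite inner_suml // (bigD1_seq i) //= orth // eqxx mulr1.
  rewrite big_seq_cond big1 ?addr0 // => j /andP[jS ji].
  by rewrite orth // (negbTE ji) mulr0.
have inner_p v : L2 mu v -> {in S, forall i, inner mu v (e i) = c i} -> inner mu p v = s%:C.
  move=> Lv ve; rewrite inner_suml // rmorph_sum big_seq [RHS]big_seq; apply: eq_bigr => i iS.
  by rewrite (innerC Lv) // ve // mulc_conj.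
have pf : inner mu p f = s%:C by exact: inner_p.
have pp : inner mu p p = s%:C by exact: inner_p.
have fp : inner mu f p = s%:C by rewrite (innerC Lp) // pf conjc_real.
have Lfp : L2 mu (fun x => f x - p x) by exact: L2B.
have : L2sq (fun x => f x - p x) = L2sq f - s.
  have realB : (L2sq f)%:C - s%:C = (L2sq f - s)%:C by rewrite rmorphB.
  apply: (@complexI R); rewrite -inner_self innerBl //.
  rewrite (innerC Lfp Lf) (innerC Lfp Lp) !innerBl // pf pp fp subrr inner_self.
  by rewrite realB conjc_real conjc0 subr0.
by have := L2sq_ge0 (fun x => f x - p x); rewrite -/s; lra.
Qed.

End SquareIntegrable.

(** * Passage to the limit *)

Section FrameBound.
Variables (R : realType) (d : nat).
Implicit Types (X T : seq 'rV[R]_d) (g : 'rV[R]_d -> R[i]) (l : 'rV[int]_d).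

Lemma mean_sumset_echarB X T g l :
  mean [seq x + y | x <- X, y <- T] (fun z => g z * echar l z) -
    mean X (fun x => g x * echar l x) * fourier T (intrv R l) =
  mean T (fun y => echar l y * mean X (fun x => (g (x + y) - g x) * echar l x)).
Proof.
rewrite mulr_mean mean_allpairs -[X in _ - X]mul1r -mulNr -meanZl -meanD.
rewrite [RHS](_ : _ = mean X (fun x => mean T (fun y =>
  echar l y * ((g (x + y) - g x) * echar l x)))).
  apply: eq_mean => x; rewrite -meanZl -meanD; apply: eq_mean => y.
  by rewrite echarDr -/(echar l y); ring.
by rewrite exchange_mean; apply: eq_mean => y; rewrite -meanZl.
Qed.

Lemma sum_sqnormc_echarB_le X T (S : seq 'rV[int]_d) g (w : R) :
  (0 < size X)%N -> (0 < size T)%N -> parseval (@echar R d) X S ->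
  (forall x, {in T, forall y, sqnormc (g (x + y) - g x) <= w}) ->
  \sum_(l <- S) sqnormc (mean [seq x + y | x <- X, y <- T] (fun z => g z * echar l z) -
    mean X (fun x => g x * echar l x) * fourier T (intrv R l)) <= w.
Proof.
move=> X0 T0 S_parseval osc; pose c l y := mean X (fun x => (g (x + y) - g x) * echar l x).
apply: (@le_trans _ _ (\sum_(l <- S) mean T (fun y => sqnormc (c l y)))).
  apply: ler_sum => l _; rewrite mean_sumset_echarB; apply: le_trans (sqnormc_mean_le _ _) _.
  by apply: ler_mean => y _; rewrite sqnormcM sqnormc_echar mul1r.
rewrite -mean_sum; apply: mean_le_cst => // y yT; rewrite S_parseval.
by apply: mean_le_cst => // x _; exact: osc.
Qed.

(* The Fourier coefficients of [g] on the sumset are, up to the oscillation of [g]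
   along [T], those on [X] multiplied by the transform of [T]. *)
Lemma frame_bound_sumset X T (S : seq 'rV[int]_d) (eps w : R) g :
  (0 < size X)%N -> (0 < size T)%N -> parseval (@echar R d) X S ->
  {in S, forall l, eps <= energy T (intrv R l)} ->
  (forall x, {in T, forall y, sqnormc (g (x + y) - g x) <= w}) ->
  eps * mean X (fun x => sqnormc (g x)) <= 2 * (w +
    \sum_(l <- S) sqnormc (mean [seq x + y | x <- X, y <- T] (fun z => g z * echar l z))).
Proof.
move=> X0 T0 S_parseval S_eps /(sum_sqnormc_echarB_le X0 T0 S_parseval).
pose a l := mean X (fun x => g x * echar l x) * fourier T (intrv R l).
pose c l := mean [seq x + y | x <- X, y <- T] (fun z => g z * echar l z).
move=> err_le.
apply: (@le_trans _ _ (\sum_(l <- S) sqnormc (a l))).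
  rewrite -S_parseval mulr_sumr big_seq [leRHS]big_seq; apply: ler_sum => l lS.
  by rewrite [leRHS]sqnormcM mulrC ler_wpM2l ?sqnormc_ge0 // S_eps.
apply: (@le_trans _ _ (\sum_(l <- S) 2 * (sqnormc (a l - c l) + sqnormc (c l)))).
  by apply: ler_sum => l _; rewrite -[in leLHS](subrK (c l) (a l)) sqnormcD_le.
rewrite -mulr_sumr ler_pM2l // big_split lerD2r; apply: le_trans err_le.
by apply: ler_sum => l _; rewrite -sqnormcN opprB.
Qed.

End FrameBound.

Section BoundedContinuous.
Variables (R : realType) (d : nat).
Implicit Types (F G : 'rV[R]_d -> R[i]).

Definition bounded_continuous F : Prop :=
  [/\ continuous (fun x => Re (F x)), continuous (fun x => Im (F x))
    & exists M, forall x, sqnormc (F x) <= M].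

Lemma dotv_continuous (u : 'rV[R]_d) : continuous (dotv u).
Proof.
apply: lipschitz_continuous; exists (\sum_i `|u 0 i|) => x y.
by rewrite -dotvNr -dotvDr; apply: norm_dotv_le => i; exact: norm_coord_le.
Qed.

Lemma bounded_continuous_expo (lam : 'rV[R]_d) : bounded_continuous (expo lam).
Proof.
have c2 : continuous (fun x => 2 * pi * dotv lam x).
  move=> x; apply: (@continuousM _ _ (fun=> 2 * pi) (dotv lam)).
    exact: cst_continuous.
  exact: dotv_continuous.
split; last by exists 1 => x; rewrite (sqnormc_expi2pi (dotv lam x)).
- by move=> x; apply: (continuous_comp (c2 x)); exact: continuous_cos.
- by move=> x; apply: (continuous_comp (c2 x)); exact: continuous_sin.
Qed.

Lemma bounded_continuous_echar (l : 'rV[int]_d) : bounded_continuous (echar l).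
Proof.
rewrite (_ : echar l = expo (- intrv R l)); first exact: bounded_continuous_expo.
by apply/funext => x; rewrite /expo dotvNl.
Qed.

Lemma bounded_continuousM F G : bounded_continuous F -> bounded_continuous G ->
  bounded_continuous (fun x => F x * G x).
Proof.
move=> [f1 f2 [M FM]] [g1 g2 [N GN]]; split.
- under eq_fun do rewrite ReM.
  by move=> x; exact: (continuousB (continuousM (f1 x) (g1 x)) (continuousM (f2 x) (g2 x))).
- under eq_fun do rewrite ImM.
  by move=> x; exact: (continuousD (continuousM (f1 x) (g2 x)) (continuousM (f2 x) (g1 x))).
- by exists (M * N) => x; rewrite sqnormcM ler_pM ?sqnormc_ge0.
Qed.

Lemma bounded_continuous_L2 (mu : probability (Rd R d) R) F : bounded_continuous F -> L2 mu F.
Proof.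
move=> [/continuous_measurable_borel f1 /continuous_measurable_borel f2 [M FM]].
exact: L2_bounded FM.
Qed.

Lemma continuous_sqnormc F : bounded_continuous F -> continuous (fun x => sqnormc (F x)).
Proof.
move=> [f1 f2 _] x.
exact: (continuousD (continuousM (f1 x) (f1 x)) (continuousM (f2 x) (f2 x))).
Qed.

Definition cbounded_lipschitz F : Prop :=
  bounded_lipschitz (fun x => Re (F x)) /\ bounded_lipschitz (fun x => Im (F x)).

Lemma cbounded_lipschitz_continuous F : cbounded_lipschitz F -> bounded_continuous F.
Proof.
move=> [[/lipschitz_continuous c1 [M HM]] [/lipschitz_continuous c2 [N HN]]]; split=> //.
exists (M ^+ 2 + N ^+ 2) => x; rewrite /sqnormc.
have sqr_le (a b : R) : `|a| <= b -> a ^+ 2 <= b ^+ 2.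
  by move=> ab; rewrite -real_normK ?num_real // lerXn2r // nnegrE (le_trans _ ab).
by rewrite lerD // sqr_le.
Qed.

Lemma cbounded_lipschitz_oscillation F : cbounded_lipschitz F ->
  exists2 C : R, 0 <= C & forall x y, sqnormc (F (x + y) - F x) <= C * `|y| ^+ 2.
Proof.
move=> [[[K HK] _] [[L HL] _]]; exists (K ^+ 2 + L ^+ 2) => [|x y].
  by rewrite addr_ge0 ?sqr_ge0.
have sqr_le (h : 'rV[R]_d -> R) (M : R) : (forall x y, `|h x - h y| <= M * `|x - y|) ->
    (h (x + y) - h x) ^+ 2 <= M ^+ 2 * `|y| ^+ 2.
  move=> Hh; have hy : `|h (x + y) - h x| <= M * `|y|.
    by have := Hh (x + y) x; rewrite [x + y - x]addrAC subrr add0r.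
  rewrite -real_normK ?num_real // -exprMn lerXn2r // nnegrE.
  exact: le_trans hy.
rewrite /sqnormc !raddfB mulrDl.
exact: lerD (sqr_le (fun x => Re (F x)) K HK) (sqr_le (fun x => Im (F x)) L HL).
Qed.

Lemma exists_cbounded_lipschitz_near (mu : probability (Rd R d) R) (f : Rd R d -> R[i])
    (eta : R) : L2 mu f -> 0 < eta ->
  exists2 g, cbounded_lipschitz g & L2sq mu (fun x => f x - g x) <= eta.
Proof.
move=> Lf eta0; have eta2 : 0 < eta / 2 by rewrite divr_gt0.
have [f1 [f2 _]] := Lf; have [if1 if2] := L2_sqr_integrable Lf.
have [g1 B1 near1] := exists_bounded_lipschitz_near f1 if1 eta2.
have [g2 B2 near2] := exists_bounded_lipschitz_near f2 if2 eta2.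
pose g (x : 'rV[R]_d) := (g1 x +i* g2 x)%C; have Bg : cbounded_lipschitz g by [].
exists g => //; have Lg := bounded_continuous_L2 mu (cbounded_lipschitz_continuous Bg).
have [ifg1 ifg2] := L2_sqr_integrable (L2B Lf Lg).
rewrite /L2sq /sqnormc RintegralD // (splitr eta); apply: lerD.
  by under eq_Rintegral do rewrite raddfB; exact: near1.
by under eq_Rintegral do rewrite raddfB; exact: near2.
Qed.

End BoundedContinuous.

Section WeakLimit.
Variables (R : realType) (d : nat) (mu : probability (Rd R d) R).
Variables (m : nat -> 'I_d -> nat) (Bs : nat -> seq 'rV[int]_d).
Hypothesis mu_limit : weak_limit m Bs mu.
Implicit Types (F : 'rV[R]_d -> R[i]) (u : nat -> nat).

Local Notation X n := (conv_points R m Bs n).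

Lemma weak_limit_mean (f : 'rV[R]_d -> R) (M : R) u :
  continuous f -> (forall x, f x ^+ 2 <= M) -> u k @[k --> \oo] --> \oo ->
  mean (X (u k)) f @[k --> \oo] --> Rintegral mu setT (f : Rd R d -> R).
Proof.
move=> cf fM uoo; have f_bounded : exists M, forall x, `|f x| <= M.
  exists (M + 1) => x; have := fM x; rewrite -real_normK ?num_real //.
  by have := normr_ge0 (f x); nra.
exact: cvg_comp uoo (mu_limit cf f_bounded).
Qed.

Lemma weak_limit_Re_mean F u : bounded_continuous F -> u k @[k --> \oo] --> \oo ->
  Re (mean (X (u k)) F) @[k --> \oo] --> Re (cintegral mu F).
Proof.
move=> [f1 _ [M FM]] uoo; under eq_fun do rewrite Re_mean.
by apply: (@weak_limit_mean _ M) => // x; exact: le_trans (sqr_Re_le _) (FM x).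
Qed.

Lemma weak_limit_Im_mean F u : bounded_continuous F -> u k @[k --> \oo] --> \oo ->
  Im (mean (X (u k)) F) @[k --> \oo] --> Im (cintegral mu F).
Proof.
move=> [_ f2 [M FM]] uoo; under eq_fun do rewrite Im_mean.
by apply: (@weak_limit_mean _ M) => // x; exact: le_trans (sqr_Im_le _) (FM x).
Qed.

Lemma weak_limit_sqnormc_mean F u : bounded_continuous F -> u k @[k --> \oo] --> \oo ->
  sqnormc (mean (X (u k)) F) @[k --> \oo] --> sqnormc (cintegral mu F).
Proof.
move=> bF uoo; have cRe := weak_limit_Re_mean bF uoo; have cIm := weak_limit_Im_mean bF uoo.
exact: cvgD (cvgM cRe cRe) (cvgM cIm cIm).
Qed.

Lemma cintegral_eq_near F u (c : R[i]) : bounded_continuous F ->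
  u k @[k --> \oo] --> \oo -> (\forall k \near \oo, mean (X (u k)) F = c) ->
  cintegral mu F = c.
Proof.
move=> bF uoo Hc; apply/eqP; rewrite eq_complex; apply/andP; split; apply/eqP.
  apply: cvg_unique (weak_limit_Re_mean bF uoo) _ => //.
  by apply: cvg_near_cst; apply: filterS Hc => k ->.
apply: cvg_unique (weak_limit_Im_mean bF uoo) _ => //.
by apply: cvg_near_cst; apply: filterS Hc => k ->.
Qed.

End WeakLimit.

Section LimitSpectrum.
Variables (R : realType) (d : nat) (mu : probability (Rd R d) R).
Variables (m : nat -> 'I_d -> nat) (Bs : nat -> seq 'rV[int]_d).
Hypothesis mBs_Dd : Dd_seq m Bs.
Hypothesis mu_limit : weak_limit m Bs mu.
Variables (eps : R) (ns : nat -> nat) (S : nat -> seq 'rV[int]_d).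
Hypothesis eps_gt0 : 0 < eps.
Hypothesis S_tower : spectral_tower m Bs eps ns S.
Implicit Types (l : 'rV[int]_d) (f : Rd R d -> R[i]) (g : 'rV[R]_d -> R[i]).

Local Notation X n := (conv_points R m Bs n).
Local Notation e l := (expo (intrv R l)).

Let ns_cvg : ns k @[k --> \oo] --> \oo.
Proof.
apply/cvgnyPge => A; near=> k; have [kn _ _ _] := S_tower k.
by apply: leq_trans kn; near: k; exact: nbhs_infty_ge.
Unshelve. all: by end_near. Qed.

Let S_parseval j : parseval (@echar R d) (X (ns j)) (S j).
Proof. by case: (S_tower j). Qed.

Lemma spectral_tower_mono i j : (i <= j)%N -> {subset S i <= S j}.
Proof.
move=> /subnKC <-; elim: (j - i)%N => [|k IHk] l; first by rewrite addn0.
by rewrite addnS => /IHk; have [_ _ + _] := S_tower (i + k)%N; apply.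
Qed.

Lemma L2_expo lam : L2 mu (expo lam).
Proof. exact/bounded_continuous_L2/bounded_continuous_expo. Qed.

Lemma inner_expo f l : inner mu f (e l) = cintegral mu (fun x => f x * echar l x).
Proof. by rewrite /inner; under eq_fun do rewrite -[e l _]conjc_echar conjcK. Qed.

Lemma spectrum_orthonormal i j l l' : l \in S i -> l' \in S j ->
  inner mu (e l) (e l') = (l == l')%:R.
Proof.
move=> lS l'S; rewrite inner_expo; apply: (cintegral_eq_near mu_limit _ ns_cvg).
  exact: bounded_continuousM (bounded_continuous_expo _) (bounded_continuous_echar R l').
near=> k; have lk : l \in S k by apply: spectral_tower_mono lS; near: k; exact: nbhs_infty_ge.
have l'k : l' \in S k by apply: spectral_tower_mono l'S; near: k; exact: nbhs_infty_ge.
under eq_fun do rewrite -[e l _]conjc_echar.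
have X_gt0 := size_conv_points_gt0 R mBs_Dd (ns k).
have [<-|ll'] := eqVneq l l'; last first.
  exact: (parseval_orthogonal X_gt0 (@sqnormc_echar R d) (@S_parseval k)).
by under eq_fun do rewrite mulrC mulc_conj sqnormc_echar; rewrite mean_cst.
Unshelve. all: by end_near. Qed.

(* Let [k] tend to infinity in the frame bound on the sumset [X (ns j + k)]. *)
Lemma level_frame_bound j g (w : R) : bounded_continuous g ->
  (forall k x, {in tail_points R m Bs (ns j) k, forall y,
     sqnormc (g (x + unscale (level_scale m (ns j)) y) - g x) <= w}) ->
  eps * mean (X (ns j)) (fun x => sqnormc (g x)) <=
  2 * (w + \sum_(l <- S j) sqnormc (inner mu g (e l))).
Proof.
move=> bg osc; pose sc := level_scale m (ns j); pose T k := tail_points R m Bs (ns j) k.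
have [_ _ _ energy_ge] := S_tower j.
pose coef k := \sum_(l <- S j) sqnormc (mean (X (ns j + k)) (fun x => g x * echar l x)).
have bound k : eps * mean (X (ns j)) (fun x => sqnormc (g x)) <= 2 * (w + coef k).
  rewrite /coef conv_pointsD -(allpairs_mapr +%R (fun _ => unscale sc)).
  apply: frame_bound_sumset => // [|||x _ /mapP[y yT ->]]; last exact: osc yT.
  - exact: size_conv_points_gt0.
  - by rewrite size_map; exact: size_conv_points_gt0 (Dd_drop_levels _ mBs_Dd) _.
  - by move=> l lS; rewrite energy_map_unscale; exact: energy_ge.
have bound_cvg : 2 * (w + coef k) @[k --> \oo] -->
    2 * (w + \sum_(l <- S j) sqnormc (inner mu g (e l))).
  apply: cvgM; first exact: cvg_cst.
  apply: cvgD; first exact: cvg_cst.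
  apply: (cvg_big (add_continuous (s := R))) => l _; rewrite inner_expo.
  apply: weak_limit_sqnormc_mean (cvg_addnl (ns j)) => //.
  exact: bounded_continuousM (bounded_continuous_echar R l).
by apply: (ler_cvg_to (cvg_cst _) bound_cvg); exact: nearW.
Qed.

Lemma lower_frame_bound g (b : R) : cbounded_lipschitz g ->
  (forall j, \sum_(l <- S j) sqnormc (inner mu g (e l)) <= b) ->
  eps * L2sq mu g <= 2 * b.
Proof.
move=> Lg coef_le; have bg := cbounded_lipschitz_continuous Lg.
have [C C0 osc] := cbounded_lipschitz_oscillation Lg.
have bound j : eps * mean (X (ns j)) (fun x => sqnormc (g x)) <=
    2 * (geometric C 4^-1 j + b).
  apply: le_trans (level_frame_bound (w := geometric C 4^-1 j) bg _) _; last first.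
    by rewrite ler_pM2l // lerD2l.
  move=> k x y /(norm_unscale_tail_le mBs_Dd) y_le; apply: le_trans (osc _ _) _.
  have y2 : `|unscale (level_scale m (ns j)) y| ^+ 2 <= 4^-1 ^+ j.
    have [jn _ _ _] := S_tower j.
    have -> : 4^-1 ^+ j = ((2 ^+ j)^-1) ^+ 2 :> R.
      by rewrite -exprVn -exprM mulnC exprM; congr (_ ^+ j); field.
    rewrite lerXn2r ?nnegrE ?invr_ge0 ?exprn_ge0 // (le_trans y_le) //.
    by rewrite lef_pV2 ?posrE ?exprn_gt0 // ler_weXn2l // ler1n.
  exact: ler_wpM2l C0 _ _ y2.
have [_ _ [M gM]] := bg.
have lhs_cvg : eps * mean (X (ns j)) (fun x => sqnormc (g x)) @[j --> \oo] --> eps * L2sq mu g.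
  apply: cvgM; first exact: cvg_cst.
  apply: (weak_limit_mean mu_limit (M := M ^+ 2) (continuous_sqnormc bg) _ ns_cvg) => x.
  by rewrite lerXn2r ?nnegrE ?sqnormc_ge0 // (le_trans _ (gM x)) ?sqnormc_ge0.
have rhs_cvg : 2 * (geometric C 4^-1 j + b) @[j --> \oo] --> 2 * (0 + b).
  apply: cvgM; first exact: cvg_cst.
  apply: cvgD; last exact: cvg_cst.
  apply: cvg_geometric.
  by rewrite ger0_norm ?invf_lt1 ?ltr1n.
by rewrite -[b in leRHS]add0r; apply: (ler_cvg_to lhs_cvg rhs_cvg); exact: nearW.
Qed.

Lemma L2sq_orthogonal_le f g : L2 mu f -> cbounded_lipschitz g ->
  (forall j, {in S j, forall l, inner mu f (e l) = 0}) ->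
  L2sq mu f <= 2 * (1 + 2 / eps) * L2sq mu (fun x => f x - g x).
Proof.
move=> Lf Bg orth; have Lg := bounded_continuous_L2 mu (cbounded_lipschitz_continuous Bg).
set D := L2sq mu (fun x => f x - g x); have Lfg := L2B Lf Lg.
have coef_le j : \sum_(l <- S j) sqnormc (inner mu g (e l)) <= D.
  rewrite (eq_big_seq (fun l => sqnormc (inner mu (fun x => f x - g x) (e l)))).
    apply: bessel Lfg _ => [|l|l l']; [|exact: L2_expo|exact: spectrum_orthonormal].
    apply: parseval_uniq (@S_parseval j); last exact: sqnormc_echar.
    exact: size_conv_points_gt0.
  move=> l lS; rewrite innerBl ?(orth j) ?sub0r ?sqnormcN //; exact: L2_expo.
have g_le : L2sq mu g <= 2 / eps * D.
  by rewrite mulrAC ler_pdivlMr // mulrC; exact: lower_frame_bound.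
have -> : f = (fun x => (f x - g x) + g x) by apply/funext => x; rewrite subrK.
apply: le_trans (L2sqD_le Lfg Lg) _; rewrite -/D -mulrA ler_pM2l //.
by rewrite mulrDl mul1r lerD2l.
Qed.

Lemma spectrum_complete f : L2 mu f -> (forall j, {in S j, forall l, inner mu f (e l) = 0}) ->
  {ae mu, forall x, f x = 0}.
Proof.
move=> Lf orth; apply: (L2sq_eq0_ae Lf); apply/eqP; rewrite eq_le L2sq_ge0 andbT.
pose c : R := 2 * (1 + 2 / eps); have c0 : 0 < c by rewrite mulr_gt0 ?addr_gt0 ?divr_gt0.
apply/ler_addgt0Pr => eta eta0; rewrite add0r.
have [g Bg near_g] := exists_cbounded_lipschitz_near Lf (divr_gt0 eta0 c0).
apply: le_trans (L2sq_orthogonal_le Lf Bg orth) _; rewrite -/c.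
by apply: le_trans (ler_wpM2l (ltW c0) near_g) _; rewrite mulrCA divff ?mulr1 // gt_eqF.
Qed.

Definition limit_frequencies : set 'rV[R]_d :=
  [set intrv R l | l in [set l | exists j, l \in S j]].

Lemma limit_frequencies_Zd : limit_frequencies `<=` @Zd R d.
Proof. by move=> _ [l _ <-] i; rewrite mxE intr_int. Qed.

Lemma limit_frequencies_spectrum : is_spectrum mu limit_frequencies.
Proof.
split; first exact: card_le_trans (card_image_le _ _) (countableP _).
split; first by move=> _ [l _ <-]; exact: L2_expo.
split=> [_ _ [l [i lS] <-] [l' [j l'S] <-]|f Lf orth].
  by rewrite (spectrum_orthonormal lS l'S) (inj_eq (@intrv_inj R d)).
apply: spectrum_complete => // j l lS; apply: orth.
by exists l => //; exists j.
Qed.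

End LimitSpectrum.

Lemma recurrent_pair (d : nat) (m : nat -> 'I_d -> nat) (Bs : nat -> seq 'rV[int]_d)
    (m0 : 'I_d -> nat) (B0 : seq 'rV[int]_d) : Dd_seq m Bs ->
  (forall N, exists n, (N <= n)%N /\ (forall i, m n i = m0 i) /\ Bs n =i B0) ->
  forall N, exists n, [/\ (N <= n)%N, m n = m0 & perm_eq (Bs n) (undup B0)].
Proof.
move=> mBs_Dd recur N; have [n [Nn [mE BE]]] := recur N; exists n; split=> //.
  exact/funext.
apply: uniq_perm => [||b]; rewrite ?undup_uniq ?mem_undup //.
by case: (mBs_Dd n) => _ [].
Qed.

Theorem theorem1p6 (R : realType) (d : nat)
    (m : nat -> 'I_d -> nat) (Bs : nat -> seq 'rV[int]_d)
    (HD : forall n, in_Dd (m n) (Bs n))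
    (Hadm : forall n, admissible R (m n) (Bs n))
    (Hrep : exists (m0 : 'I_d -> nat) (B0 : seq 'rV[int]_d),
        (forall i, (d.+1 <= m0 i)%N) /\
        (forall N : nat, exists n : nat, (N <= n)%N /\
           (forall i, m n i = m0 i) /\ Bs n =i B0))
    (mu : probability (Rd R d) R)
    (Hmu : weak_limit m Bs mu) :
  exists Lam : set 'rV[R]_d, Lam `<=` @Zd R d /\ is_spectrum mu Lam.
Proof.
have [m0 [B0 [d_lt_m0 /(recurrent_pair HD) recur]]] := Hrep.
have [eps eps_gt0 [ns [S S_tower]]] := exists_spectral_tower HD Hadm d_lt_m0 recur.
exists (limit_frequencies S); split; first exact: limit_frequencies_Zd.
exact: (limit_frequencies_spectrum HD Hmu eps_gt0 S_tower).
Qed.
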